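(* For every integer $n \geq 3$ there is an $n$-gon $S\subseteq\mathbb{R}^2$ such that for all $\alpha\in[0,1)$ the class $\mathcal{G}(S,\alpha)$ of intersection graphs of $\alpha$-free homothetic copies of $S$ does not admit product structure.
   Context: All graphs and collections are finite. An $n$-gon is a closed filled polygon with $n$ corners; $\lVert S\rVert$ denotes the area of $S \subseteq \mathbb{R}^2$. $\alpha$-free: a homothetic copy of $S\subseteq\mathbb{R}^2$ is a set obtained from $S$ by positive scaling and translation. For $\alpha \in[0,1]$, a collection $\{S_v\}_{v\in V}$ of homothetic copies of $S$ is $\alpha$-free if for every $v\in V$ we have $\lVert S_v \setminus \bigcup_{u\in V\setminus\{v\}} S_u\rVert \ge \alpha\lVert S_v\rVert$. The intersection graph of the collection has vertex set $V$ and an edge $uv$ (for $u\neq v$) if and only if $S_u\cap S_v\neq\emptyset$. $\mathcal{G}(S,\alpha)$ is the class of all intersection graphs of $\alpha$-free collections of homothetic copies of $S$. Product structure: the strong product $G\boxtimes H$ has vertex set $V(G)\times V(H)$, with distinct vertices $(u,u'),(v,v')$ adjacent iff ($u=v$ or $uv\in E(G)$) and ($u'=v'$ or $u'v'\in E(H)$). A graph class $\mathcal{G}$ admits product structure if there is a constant $t$ such that every $G\in\mathcal{G}$ is a subgraph of $H\boxtimes P$ for some path $P$ and some graph $H$ of treewidth at most $t$. *)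

(* Defs.v *)
From HB Require Import structures.
From mathcomp Require Import all_boot all_order all_algebra.
From mathcomp Require Import all_classical all_reals all_analysis.

Set Implicit Arguments.
Unset Strict Implicit.
Unset Printing Implicit Defensive.

Import Order.TTheory GRing.Theory Num.Theory.
Import numFieldNormedType.Exports.

Local Open Scope classical_set_scope.
Local Open Scope ring_scope.

Record sgraph : Type := SGraph {
  vertex :> finType;
  adj : rel vertex;
  adj_sym : symmetric adj;
  adj_irrefl : irreflexive adj }.

(* Subgraph up to isomorphism, not necessarily induced. *)
Definition subgraph (G H : sgraph) : Prop :=
  exists2 f : G -> H, injective f & forall u v : G, adj u v -> adj (f u) (f v).

Section StrongProduct.
Variables G H : sgraph.

Definition strong_adj : rel (G * H)%type := fun x y =>
  [&& x != y, (x.1 == y.1) || adj x.1 y.1 & (x.2 == y.2) || adj x.2 y.2].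

Lemma strong_adj_sym : symmetric strong_adj.
Proof.
move=> x y; rewrite /strong_adj eq_sym (eq_sym x.1) (eq_sym x.2).
by rewrite (adj_sym x.1) (adj_sym x.2).
Qed.

Lemma strong_adj_irrefl : irreflexive strong_adj.
Proof. by move=> x; rewrite /strong_adj eqxx. Qed.

Definition strong_product : sgraph := SGraph strong_adj_sym strong_adj_irrefl.
End StrongProduct.

Section PathGraph.
Variable k : nat.

Definition path_adj : rel 'I_k.+1 := fun i j => (i.+1 == j) || (j.+1 == i).

Lemma path_adj_sym : symmetric path_adj.
Proof. by move=> i j; rewrite /path_adj orbC. Qed.

Lemma path_adj_irrefl : irreflexive path_adj.
Proof. by move=> i; rewrite /path_adj orbb gtn_eqF. Qed.

(* The path with [k] edges; every (nonempty) path is isomorphic to one. *)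
Definition path_graph : sgraph := SGraph path_adj_sym path_adj_irrefl.
End PathGraph.

Definition induces_connected (G : sgraph) (X : {set G}) : Prop :=
  {in X &, forall u v,
    connect [rel a b | [&& a \in X, b \in X & adj a b]] u v}.

(* In acyclicity, [ucycle] also accepts closed walks [:: x; y] along a single
   edge, so only those with at least 3 vertices are cycles of the graph. *)
Definition is_tree (T : sgraph) : Prop :=
  [/\ (0 < #|T|)%N, induces_connected [set: T]%SET &
      forall c : seq T, ucycle (@adj T) c -> (size c <= 2)%N].

Record tree_decomposition (G T : sgraph) (bag : T -> {set G}) : Prop := {
  td_tree : is_tree T;
  td_vertex : forall v : G, exists i, v \in bag i;
  td_edge : forall u v : G, adj u v ->
    exists2 i, u \in bag i & v \in bag i;
  td_connected : forall v : G, induces_connected [set i | v \in bag i]%SET }.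

(* The width of a decomposition is the maximal bag size minus one. *)
Definition treewidth_le (G : sgraph) (t : nat) : Prop :=
  exists (T : sgraph) (bag : T -> {set G}),
    tree_decomposition bag /\ forall i, (#|bag i| <= t.+1)%N.

Definition admits_product_structure (C : sgraph -> Prop) : Prop :=
  exists t : nat, forall G : sgraph, C G ->
    exists (H : sgraph) (k : nat),
      treewidth_le H t /\ subgraph G (strong_product H (path_graph k)).

Section Plane.
Variable R : realType.
Implicit Types (S : set (R * R)) (a b c : R * R).

Definition area S : \bar R :=
  ((@lebesgue_measure R) \x (@lebesgue_measure R))%E S.

Definition homothetic_copy S S' : Prop :=
  exists (s : R) (c : R * R), 0 < s /\ S' = [set s *: x + c | x in S].

Definition alpha_free (alpha : R) (V : finType) (F : V -> set (R * R)) : Prop :=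
  forall v, (alpha%:E * area (F v)
             <= area (F v `\` \bigcup_(u in [set u | u != v]) F u))%E.

Definition is_intersection_graph (G : sgraph) (F : G -> set (R * R)) : Prop :=
  forall u v : G, adj u v <-> u != v /\ F u `&` F v !=set0.

Definition intersection_class S (alpha : R) (G : sgraph) : Prop :=
  exists F : G -> set (R * R),
    [/\ forall v, homothetic_copy S (F v), alpha_free alpha F &
        is_intersection_graph F].

Definition segment a b : set (R * R) :=
  [set (1 - t) *: a + t *: b | t in `[0, 1]].

Definition collinear a b c : Prop :=
  (b.1 - a.1) * (c.2 - a.2) = (b.2 - a.2) * (c.1 - a.1).

Section Polygon.
Variables (n : nat) (p : 'I_n -> R * R).

Definition edge (i : 'I_n) : set (R * R) := segment (p i) (p (ordS i)).

(* The closed polygonal curve through p 0, ..., p (n - 1), for n >= 3, is simple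
   and turns at each of these n points. Consecutive edges need no further
   condition: not being collinear, they share their common endpoint only. *)
Definition simple_polygon : Prop :=
  (forall i, ~ collinear (p i) (p (ordS i)) (p (ordS (ordS i)))) /\
  (forall i j, i != j -> j != ordS i -> i != ordS j ->
     edge i `&` edge j = set0).

Definition polygon_curve : set (R * R) := \bigcup_(i in [set: 'I_n]) edge i.

(* The points enclosed by the curve are those in bounded components of its
   complement. *)
Definition filled_polygon : set (R * R) :=
  polygon_curve `|`
  [set x | ~ polygon_curve x /\
           bounded_set (connected_component (~` polygon_curve) x)].
End Polygon.

(* Polygons are not required to be convex. *)
Definition is_ngon (n : nat) S : Prop :=
  exists p : 'I_n -> R * R, simple_polygon p /\ S = filled_polygon p.
End Plane.

(* Main.v *)
(**
  [S] is the right triangle with legs on the left and at the bottom whose hypotenuse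
  is dented inwards (not at all if [n = 3]); every contact used below is between a
  bottom leg and a left leg, so the dent is harmless.

  Let [G] be a subgraph of [H * P] with [H] of treewidth at most [t], all of whose
  vertices are within distance [D] of a root. Then [G] occupies at most [2 D + 1]
  layers, so a bag of [H] meets it in at most [(t + 1) (2 D + 1)] vertices. If [G] has
  [m] disjoint connected rows and [m] disjoint connected columns, each row touching each
  column, then by the Helly property of subtrees some bag meets every union of a row and
  a column, whence [m <= (t + 1) (2 D + 1)].

  The arrangement that violates this bound has rows of [R] equal hubs touching corner to
  corner, all ending at one huge wall. At the right tip of each hub [K] lines cross the
  row from below. Line [k] pokes a copy of [S] much larger than the local thickness of
  the tip through it, up to a copy that pokes back a little from above; as the scales
  decrease fast with [k], any number of lines cross the same tip, while each copy keeps
  almost all of its area to itself. A line needs at most [3 L] copies from one row to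
  the next, where [L] depends on [K] and [alpha] only. So every vertex is within distance
  [R + 3 L + 2] of the wall, while there are [K R] rows and [K R] columns; it remains to
  take [K] large compared with [t], and [R] large compared with [L].
*)

From HB Require Import structures.
Require Import Defs.
From mathcomp Require Import all_boot all_order all_algebra.
From mathcomp Require Import all_classical all_reals all_analysis.
From mathcomp Require Import measurable_realfun.
From mathcomp Require Import zify ring lra.

Set Implicit Arguments.
Unset Strict Implicit.
Unset Printing Implicit Defensive.
Import Order.TTheory GRing.Theory Num.Theory.
Import numFieldNormedType.Exports.
Local Open Scope classical_set_scope.
Local Open Scope ring_scope.

(** * Grid-like pairs of families in products of bounded treewidth *)

Section Helly.
Variable T : sgraph.
Hypothesis acyclicT : forall c : seq T, ucycle (@adj T) c -> (size c <= 2)%N.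

(** An isolated vertex counts as a leaf, for the ambient set need not stay connected. *)
Definition leaf_in (A : {set T}) (a : T) : Prop :=
  forall x y, x \in A -> y \in A -> adj a x -> adj a y -> x = y.

(** If [y] came later on the path, the edge from [x] to [y] would close a cycle with at least three
    vertices. *)
Lemma path_neighbor_head (x y : T) (p : seq T) :
  path (@adj T) x p -> uniq (x :: p) -> y \in p -> adj x y -> y = head y p.
Proof.
move=> xp Uxp yp xy; case/splitPr: p / yp xp Uxp => p1 p2.
rewrite cat_path /= => /and3P[xp1 p1y _] Uxp.
case: p1 xp1 p1y Uxp => [//|z p1] xp1 p1y Uxp.
have: ucycle (@adj T) (x :: rcons (z :: p1) y).
  apply/andP; split; last first.
    rewrite -rcons_cons -cats1.
    have: uniq (((x :: z :: p1) ++ [:: y]) ++ p2) by rewrite -catA.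
    by rewrite cat_uniq => /andP[].
  rewrite /cycle rcons_path rcons_path xp1 p1y last_rcons /=.
  by rewrite adj_sym.
by move=> /acyclicT /=; rewrite size_rcons.
Qed.

(** Without a leaf, the first vertex of any simple path in [A] has two distinct neighbours in [A],
    only one of which can lie on the path. The path then extends at its front until it has more
    vertices than [T]. *)
Lemma exists_leaf_in (A : {set T}) (a0 : T) :
  a0 \in A -> exists2 a, a \in A & leaf_in A a.
Proof.
move=> a0A; apply: contrapT => noleaf.
suff long n : exists x p, [/\ size p = n, uniq (x :: p), path (@adj T) x p &
    all (mem A) (x :: p)].
  have [x [p [sp Up _ _]]] := long #|T|.
  by have := max_card (mem (x :: p)); rewrite (card_uniqP Up) /= sp ltnn.
elim: n => [|n [x [p [sp Up xp Ap]]]].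
  by exists a0, [::]; split => //=; rewrite a0A.
have xA : x \in A by case/andP: Ap.
have [y yA [xy yp]] : exists2 y, y \in A & adj x y /\ y \notin p.
  apply: contrapT => none; apply: noleaf; exists x => // y z yA zA xy xz.
  have inp w : w \in A -> adj x w -> w \in p.
    by move=> wA xw; apply/negPn/negP => wp; apply: none; exists w.
  have := path_neighbor_head xp Up (inp _ yA xy) xy.
  have := path_neighbor_head xp Up (inp _ zA xz) xz.
  by have := inp _ yA xy; case: p {sp Up xp Ap inp none} => //= w p _ -> ->.
exists y, (x :: p); split; rewrite /= ?sp ?yA ?(adj_sym y) ?xy //.
rewrite inE negb_or yp; move: Up => /= -> ; rewrite !andbT.
by apply: contraTneq xy => ->; rewrite adj_irrefl.
Qed.

(** A simple path between two other vertices avoids a leaf: its neighbours on the path would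
    coincide. *)
Lemma induces_connected_del (A X : {set T}) (a : T) :
  leaf_in A a -> X \subset A -> induces_connected X ->
  induces_connected (X :\ a)%SET.
Proof.
move=> la XA cX u v; rewrite !inE => /andP[ua uX] /andP[va vX].
have /connectP[p0 up0 vE0] := cX u v uX vX.
have [p [up Up vE]] : exists p, [/\ path [rel a b | [&& a \in X, b \in X & adj a b]] u p,
    uniq (u :: p) & v = last u p].
  by case/shortenP: up0 vE0 => p up Up _ vE; exists p.
move=> {p0 up0 vE0}.
have ap : a \notin p.
  apply/negP => ap; case/splitPr: p / ap up Up vE => p1 p2.
  rewrite cat_path last_cat /= => /and3P[_ /and3P[zX aX za] ap2] Up vE.
  case: p2 ap2 Up vE => [_ _ vE|w p2 /= /andP[/and3P[_ wX aw] _] Up _].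
    by rewrite vE eqxx in va.
  have zw : last u p1 = w.
    by apply: la; rewrite ?(fintype.subsetP XA) // adj_sym.
  have: uniq ((u :: p1) ++ [:: a, w & p2]) by []; rewrite cat_uniq.
  case/and3P=> _ /negP[]; apply/hasP; exists w; first by rewrite !inE eqxx orbT.
  by rewrite -zw /= mem_last.
apply/connectP; exists p => //; move: up ap ua.
elim: p u {uX Up vE} => //= w p IHp u /andP[/and3P[uX wX uw] wp].
rewrite inE negb_or => /andP[aw ap] ua.
by rewrite !inE uX wX uw ua eq_sym aw /= IHp // eq_sym.
Qed.

Lemma connected_neighbor (X : {set T}) (a b : T) :
  induces_connected X -> a \in X -> b \in X -> a != b ->
  exists2 c, c \in X & adj a c.
Proof.
move=> cX aX bX; have /connectP[[|c p] /=] := cX a b aX bX.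
  by move=> _ ->; rewrite eqxx.
by case/andP=> /and3P[_ cX' ac] _ _ _; exists c.
Qed.

(** Induction on an ambient set [A], from which a leaf [a] is removed. If some member is the
    singleton of [a], all members contain [a]. Otherwise two members through [a] both contain its
    only neighbour in [A], so they still meet after the removal. *)
Lemma subtree_helly (I : eqType) (F : I -> {set T}) (i0 : I) :
  (forall i, induces_connected (F i)) ->
  (forall i j, exists x, x \in F i /\ x \in F j) ->
  exists x, forall i, x \in F i.
Proof.
move=> cF; have [A FA] : exists A : {set T}, forall i, F i \subset A.
  by exists [set: T]%SET => i; apply/fintype.subsetP => x _; rewrite inE.
move: {2}#|A| (leqnn #|A|) => n.
elim: n A F FA cF => [|n IHn] A F FA cF An FF.
  have [x [xF _]] := FF i0 i0; have := fintype.subsetP (FA i0) _ xF.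
  by move: An; rewrite leqn0 cards_eq0 => /eqP ->; rewrite inE.
have [x0 [x0F _]] := FF i0 i0.
have [a aA la] := exists_leaf_in (fintype.subsetP (FA i0) _ x0F).
have [[i Fi]|nsing] := pselect (exists i, F i = [set a]%SET).
  by exists a => j; have [x []] := FF i j; rewrite Fi inE => /eqP ->.
have other i : exists2 b, b \in F i & b != a.
  apply: contrapT => none; apply: nsing; exists i; apply/eqP.
  rewrite finset.eqEsubset; apply/andP; split.
    apply/fintype.subsetP => b bF; rewrite inE; apply/negPn/negP => ba.
    by apply: none; exists b.
  apply/fintype.subsetP => b; rewrite inE => /eqP ->.
  have [b' [b'F _]] := FF i i; case: (eqVneq b' a) => [<- //|b'a].
  by case: none; exists b'.
have [||||x xF] := IHn (A :\ a)%SET (fun i => F i :\ a)%SET.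
- by move=> i; apply: finset.setSD.
- by move=> i; apply: (induces_connected_del la).
- by move: An; rewrite (cardsD1 a) aA.
- move=> i j; have [x [xi xj]] := FF i j.
  have [xa|xa] := eqVneq x a; last by exists x; rewrite !inE xa xi.
  rewrite xa in xi xj.
  have [bi biF bia] := other i; have [bj bjF bja] := other j.
  have [|ci ciF aci] := connected_neighbor (cF i) xi biF; first by rewrite eq_sym.
  have [|cj cjF acj] := connected_neighbor (cF j) xj bjF; first by rewrite eq_sym.
  have cc : ci = cj.
    exact: la _ _ (fintype.subsetP (FA i) _ ciF) (fintype.subsetP (FA j) _ cjF) aci acj.
  exists ci; rewrite !inE ciF cc cjF andbT; split; rewrite -?cc;
  by apply: contraTneq aci => ->; rewrite adj_irrefl.
- by exists x => i; have := xF i; rewrite inE => /andP[].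
Qed.

End Helly.

Definition within (G : sgraph) (x0 : G) (n : nat) (v : G) : Prop :=
  exists p, [/\ path (@adj G) x0 p, v = last x0 p & (size p <= n)%N].

Section Within.
Variables (G : sgraph) (x0 : G).

Lemma within0 : within x0 0 x0.
Proof. by exists [::]. Qed.

Lemma withinS n u v : within x0 n u -> adj u v -> within x0 n.+1 v.
Proof.
move=> [p [xp -> sp]] uv; exists (rcons p v).
by rewrite rcons_path xp uv last_rcons size_rcons.
Qed.

Lemma within_le m n v : (m <= n)%N -> within x0 m v -> within x0 n v.
Proof. by move=> mn [p [xp vE sp]]; exists p; split=> //; apply: leq_trans mn. Qed.

End Within.

Lemma induces_connectedP (G : sgraph) (X Y : {set G}) (u v : G) :
  induces_connected X -> X \subset Y -> u \in X -> v \in X ->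
  connect [rel a b | [&& a \in Y, b \in Y & adj a b]] u v.
Proof.
move=> cX XY uX vX; have := cX u v uX vX; apply: connect_sub => a b /=.
case/and3P=> aX bX ab; apply: connect1; rewrite /= ab.
by rewrite !(fintype.subsetP XY).
Qed.

Lemma induces_connectedU (G : sgraph) (X Y : {set G}) (c : G) :
  induces_connected X -> induces_connected Y -> c \in X -> c \in Y ->
  induces_connected (X :|: Y)%SET.
Proof.
move=> cX cY cinX cinY.
have XU : X \subset (X :|: Y)%SET by apply: finset.subsetUl.
have YU : Y \subset (X :|: Y)%SET by apply: finset.subsetUr.
move=> u v; rewrite !inE => /orP[uX|uY] /orP[vX|vY].
- exact: induces_connectedP cX XU uX vX.
- apply: connect_trans (induces_connectedP cX XU uX cinX) _.
  exact: induces_connectedP cY YU cinY vY.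
- apply: connect_trans (induces_connectedP cY YU uY cinY) _.
  exact: induces_connectedP cX XU cinX vX.
- exact: induces_connectedP cY YU uY vY.
Qed.

Lemma card_window (k D p0 : nat) :
  (#|[set j : 'I_k.+1 | (j <= p0 + D)%N && (p0 <= j + D)%N]%SET| <= (2 * D).+1)%N.
Proof.
pose g (j : 'I_k.+1) : 'I_(2 * D).+1 := inord (j + D - p0)%N.
rewrite -[leqRHS]card_ord -(@card_in_imset _ _ g); first exact: max_card.
move=> i j; rewrite !inE => /andP[i1 i2] /andP[j1 j2] /(congr1 val) /=.
by rewrite !inordK; try lia; move=> ij; apply: val_inj => /=; lia.
Qed.

(** * Crossing rows and columns in a strong product with a path *)

Section ProductBramble.
Variables (G H : sgraph) (k t D m : nat) (x0 : G).
Variable f : G -> strong_product H (path_graph k).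
Hypotheses (f_inj : injective f) (f_adj : forall u v, adj u v -> adj (f u) (f v)).
Hypothesis twH : treewidth_le H t.
Hypothesis nearG : forall v, within x0 D v.
Variables row col : 'I_m -> {set G}.
Hypotheses (row_connected : forall i, induces_connected (row i))
           (col_connected : forall j, induces_connected (col j)).
Hypotheses (row_disjoint : forall i i' v, v \in row i -> v \in row i' -> i = i')
           (col_disjoint : forall j j' v, v \in col j -> v \in col j' -> j = j').
Hypothesis row_col : forall i j, exists u v,
  [/\ u \in row i, v \in col j & adj u v].

(** An edge of the product moves the path coordinate by at most one. *)
Lemma layer_within v : ((f v).2 <= (f x0).2 + D)%N && ((f x0).2 <= (f v).2 + D)%N.
Proof.
have [p [xp -> pD]] := nearG v.
suff step q x : path (@adj G) x q ->
    ((f (last x q)).2 <= (f x).2 + size q)%N /\ ((f x).2 <= (f (last x q)).2 + size q)%N.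
  have [s1 s2] := step p x0 xp; apply/andP; split.
    by apply: leq_trans s1 _; rewrite leq_add2l.
  by apply: leq_trans s2 _; rewrite leq_add2l.
have shift (a b c s : nat) : (a <= b + s)%N /\ (b <= a + s)%N ->
    (b <= c + 1)%N /\ (c <= b + 1)%N -> (a <= c + s.+1)%N /\ (c <= a + s.+1)%N by lia.
elim: q x => [|w q IHq] x /=; first by rewrite addn0.
have succ (a b : nat) : a.+1 = b -> (b <= a + 1)%N /\ (a <= b + 1)%N by lia.
case/andP=> /f_adj /and3P[_ _ xw] /IHq wq; apply: shift wq _.
case/orP: xw => [/eqP ->|/orP[] /eqP xw]; first by rewrite leq_addr.
  by have [] := succ _ _ xw.
by have [] := succ _ _ xw.
Qed.

Lemma product_bramble_bound : (m <= t.+1 * (2 * D).+1)%N.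
Proof.
have [T [bag [[[_ _ acT] tv te tc] bag_le]]] := twH.
have [->//|m0] := posnP m; pose o : 'I_m := Ordinal m0.
have share u v : adj u v -> exists i, (f u).1 \in bag i /\ (f v).1 \in bag i.
  case/f_adj/and3P=> _ /orP[/eqP ->|/te[i ui vi]] _; last by exists i.
  by have [i vi] := tv (f v).1; exists i.
pose trace (C : {set G}) := [set i | [exists v in C, (f v).1 \in bag i]]%SET.
have traceP (C : {set G}) i : i \in trace C <-> exists2 v, v \in C & (f v).1 \in bag i.
  by rewrite inE; split=> [/exists_inP|?]; last exact/exists_inP.
(* Along a walk in [C], the nodes belonging to one vertex form a subtree, and consecutive vertices
   have a common bag. *)
have trace_connected C : induces_connected C -> induces_connected (trace C).
  move=> cC a b /traceP[u uC ua] /traceP[v vC vb].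
  have fiber w : w \in C -> [set i | (f w).1 \in bag i]%SET \subset trace C.
    by move=> wC; apply/fintype.subsetP => i; rewrite inE => wi; apply/traceP; exists w.
  have /connectP[p] := cC u v uC vC.
  elim: p u a uC ua => [|w p IHp] u a uC ua /=.
    move=> _ vu; apply: induces_connectedP (tc (f u).1) (fiber u uC) _ _; rewrite inE //.
    by rewrite -vu.
  case/andP=> /and3P[_ wC uw] wp vE; have [c [uc wc]] := share u w uw.
  apply: connect_trans (IHp w c wC wc wp vE).
  by apply: induces_connectedP (tc (f u).1) (fiber u uC) _ _; rewrite inE.
have cross i j : exists c, c \in trace (row i) /\ c \in trace (col j).
  have [u [v [ui vj /share[c [uc vc]]]]] := row_col i j.
  by exists c; split; apply/traceP; [exists u|exists v].
(* The members for [(i, j)] and [(i', j')] meet because row [i] touches column [j']. *)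
have [||c cF] := @subtree_helly T acT ('I_m * 'I_m)%type
    (fun ij => trace (row ij.1) :|: trace (col ij.2))%SET (o, o).
- move=> [i j] /=; have [c [ci cj]] := cross i j.
  apply: (induces_connectedU (trace_connected _ _) (trace_connected _ _) ci cj).
    exact: row_connected.
  exact: col_connected.
- move=> [i j] [i' j'] /=; have [c [ci cj]] := cross i j'.
  by exists c; rewrite !finset.in_setU ci cj orbT.
pose Z := [set v | (f v).1 \in bag c]%SET.
have hitZ (s : 'I_m -> {set G}) :
    (forall i i' v, v \in s i -> v \in s i' -> i = i') ->
    (forall i, c \in trace (s i)) -> (m <= #|Z|)%N.
  move=> s_disjoint sc.
  have /choice[g gP] : forall i, exists v, v \in s i /\ v \in Z.
    by move=> i; have /traceP[v vs vc] := sc i; exists v; rewrite inE.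
  have g_inj : injective g.
    move=> i i' gg; apply: (s_disjoint _ _ (g i)); first by case: (gP i).
    by rewrite gg; case: (gP i').
  rewrite -[leqLHS]card_ord -(card_imset _ g_inj); apply: subset_leq_card.
  by apply/fintype.subsetP => _ /imsetP[i _ ->]; case: (gP i).
have mZ : (m <= #|Z|)%N.
  (* If some row misses the bag of [c], pairing that row with each column shows that every column
     meets the bag. *)
  have [rowc|nrow] := pselect (forall i, c \in trace (row i)).
    exact: hitZ row_disjoint rowc.
  apply: hitZ col_disjoint _ => j; apply: contrapT => ncol; apply: nrow => i.
  by have := cF (i, j); rewrite /= finset.in_setU => /orP[].
apply: leq_trans mZ _; rewrite -(card_imset _ f_inj).
pose W := [set j : 'I_k.+1 | (j <= (f x0).2 + D)%N && ((f x0).2 <= j + D)%N]%SET.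
apply: (@leq_trans #|finset.setX (bag c) W|).
  apply: subset_leq_card; apply/fintype.subsetP => _ /imsetP[v vZ ->].
  by move: vZ; rewrite !inE => ->; rewrite layer_within.
by rewrite cardsX; apply: leq_mul => //; apply: card_window.
Qed.

End ProductBramble.

(** * A triangle with one side dented inwards *)

Section Dented.
Variables (R : realType) (m : nat).
Hypothesis m_gt0 : (0 < m)%N.

(* The side opposite to the right angle follows the parabola [y = (1 - x) ^ 2], which is
   convex, so that the polygon lies below the maximum of the chords. *)
Definition knot (j : nat) : R := j%:R / m%:R.

Definition dent_point (j : nat) : R * R := (1 - knot j, knot j ^+ 2).

(** The corners run counterclockwise: the right angle, then the parabola from [(1, 0)] to
    [(0, 1)]. *)
Definition dent_vertex (i : 'I_m.+2) : R * R :=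
  if val i is j.+1 then dent_point j else (0, 0).

(** The secant of the parabola through [dent_point j] and [dent_point j.+1]. *)
Definition chord (j : nat) (x : R) : R :=
  (knot j + knot j.+1) * (1 - x) - knot j * knot j.+1.

Local Notation d := (m%:R^-1 : R).

Lemma step_gt0 : 0 < d.
Proof. by rewrite invr_gt0 ltr0n. Qed.

Lemma knot0 : knot 0 = 0.
Proof. by rewrite /knot mul0r. Qed.

Lemma knotm : knot m = 1.
Proof. by rewrite /knot divff // pnatr_eq0 -lt0n. Qed.

Lemma knotS j : knot j.+1 = knot j + d.
Proof. by rewrite /knot -natr1 mulrDl mul1r. Qed.

Lemma knot_ge0 j : 0 <= knot j.
Proof. by rewrite divr_ge0. Qed.

Lemma le_knot i j : (i <= j)%N -> knot i <= knot j.
Proof. by move=> ij; rewrite ler_pM2r ?step_gt0 // ler_nat. Qed.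

Lemma lt_knot i j : (i < j)%N -> knot i < knot j.
Proof. by move=> ij; rewrite ltr_pM2r ?step_gt0 // ltr_nat. Qed.

Lemma knot_le1 j : (j <= m)%N -> knot j <= 1.
Proof. by rewrite -knotm; apply: le_knot. Qed.

Lemma dent_vertexE (k : nat) (i : 'I_m.+2) :
  val i = k -> dent_vertex i = if k is j.+1 then dent_point j else (0, 0).
Proof. by rewrite /dent_vertex => ->. Qed.

Lemma val_ordS (i : 'I_m.+2) :
  val (ordS i) = if val i == m.+1 then 0%N else (val i).+1.
Proof.
rewrite /=; case: eqP => [->|ne]; first by rewrite modnn.
by rewrite modn_small //; have := ltn_ord i; lia.
Qed.

Lemma segmentP (a b z : R * R) : segment a b z <->
  exists t, [/\ 0 <= t, t <= 1, z.1 = (1 - t) * a.1 + t * b.1 &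
    z.2 = (1 - t) * a.2 + t * b.2].
Proof.
split=> [[t /=]|[t [t0 t1 z1 z2]]].
  by rewrite in_itv /= => /andP[t0 t1] <-; exists t.
exists t; first by rewrite /= in_itv /= t0.
by case: z z1 z2 => x y /= -> ->.
Qed.

(** Equations in place of the parameter of a segment: first the bottom leg, then the chords from
    right to left, last the left leg. *)
Definition dent_edge (k : nat) (z : R * R) : Prop :=
  if k is j.+1 then
    if (j < m)%N then
      [/\ 1 - knot j.+1 <= z.1, z.1 <= 1 - knot j & z.2 = chord j z.1]
    else [/\ z.1 = 0, 0 <= z.2 & z.2 <= 1]
  else [/\ z.2 = 0, 0 <= z.1 & z.1 <= 1].

Lemma dent_edgeP (i : 'I_m.+2) (z : R * R) :
  edge dent_vertex i z <-> dent_edge (val i) z.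
Proof.
rewrite /edge segmentP (dent_vertexE (erefl (val i))) (dent_vertexE (val_ordS i)).
have : (val i < m.+2)%N := ltn_ord i; case: (val i) => [|j] /= jm.
  rewrite knot0 expr0n subr0 /=; split.
    by move=> [t [t0 t1 -> ->]]; split; lra.
  by move=> [z2 z1 z1']; exists z.1; split => //; rewrite ?z2; ring.
rewrite eqSS; case: (eqVneq j m) => [->|ne].
  rewrite ltnn knotm subrr expr1n /=; split.
    by move=> [t [t0 t1 -> ->]]; split; lra.
  by move=> [z1 z2 z2']; exists (1 - z.2); split; rewrite ?z1 ; lra.
have -> : (j < m)%N by rewrite ltn_neqAle ne; rewrite -ltnS -ltnS.
have d0 := step_gt0; rewrite /chord /dent_point /= !knotS; split.
  move=> [t [t0 t1 -> ->]] /=.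
  have td0 : 0 <= t * d by rewrite mulr_ge0 // ltW.
  have td1 : t * d <= d by rewrite ler_piMl // ltW.
  by split; [lra|lra|ring].
move=> [z1 z1' z2]; exists ((1 - z.1 - knot j) / d).
have dV : d / d = 1 by rewrite divff // gt_eqF.
split.
- by rewrite ler_pdivlMr // mul0r; lra.
- by rewrite ler_pdivrMr // mul1r; lra.
- by field; rewrite pnatr_eq0 -lt0n.
- rewrite z2; field; by rewrite pnatr_eq0 -lt0n.
Qed.

Lemma dent_noncollinear (i : 'I_m.+2) :
  ~ collinear (dent_vertex i) (dent_vertex (ordS i)) (dent_vertex (ordS (ordS i))).
Proof.
have d0 := step_gt0; rewrite /collinear.
rewrite (dent_vertexE (erefl (val i))) (dent_vertexE (val_ordS i)).
rewrite (dent_vertexE (val_ordS (ordS i))) val_ordS.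
have : (val i < m.+2)%N := ltn_ord i; case: (val i) => [|j] jm.
  rewrite (_ : 0%N == m.+1 = false) // (_ : 1%N == m.+1 = false); last first.
    by rewrite eqSS eq_sym gtn_eqF.
  rewrite /dent_point knotS knot0 /=.
  by have := mulr_gt0 d0 d0; lra.
case: (eqVneq j.+1 m.+1) => [[->]|ne].
  rewrite (_ : 0%N == m.+1 = false) // /dent_point knotm knot0 /=; lra.
have {}ne : (j.+1 < m.+1)%N by rewrite ltn_neqAle ne -ltnS.
case: (eqVneq j.+2 m.+1) => [[jE]|ne'].
  have := knotS j; rewrite jE knotm /dent_point /= => kj.
  by have -> : knot j = 1 - d; [lra|rewrite knotm; lra].
rewrite /dent_point !knotS /=.
(* For three consecutive points of the parabola the determinant is a nonzero multiple of [d ^ 3]. *)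
have := mulr_gt0 d0 (mulr_gt0 d0 d0); move=> d3 H.
suff : d * (d * d) = 0 by lra.
lra.
Qed.

(** Non-consecutive chords, and the left leg, have disjoint ranges of abscissas. A chord [j' > 0]
    stays at height at least [knot j' ^ 2] over its own range, hence off the bottom leg. *)
Lemma dent_edges_disjoint (i j : 'I_m.+2) :
  i != j -> j != ordS i -> i != ordS j ->
  edge dent_vertex i `&` edge dent_vertex j = set0.
Proof.
wlog : i j / (val i < val j)%N => [ih|ij _].
  move=> ij ji ji'; have : val i != val j by [].
  rewrite neq_ltn => /orP[?|?]; first exact: ih.
  by rewrite setIC; apply: ih; rewrite // eq_sym.
rewrite -(inj_eq val_inj) -(inj_eq val_inj i) !val_ordS => Sij Sji.
apply/seteqP; split => // z [/dent_edgeP + /dent_edgeP]; move: ij Sij Sji.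
have : (val j < m.+2)%N := ltn_ord j.
case: (val i) (val j) => [|i'] [|j'] //=.
- rewrite !eqSS => jm _ j0 jm'; have {}j0 : (0 < j')%N by rewrite lt0n.
  have {}jm' : (j' < m)%N.
    rewrite ltn_neqAle -ltnS -ltnS jm andbT.
    by apply: contraNneq jm' => ->; rewrite eqxx.
  move=> [z2 _ _]; rewrite jm' => -[_ z1]; rewrite z2 /chord => ch.
  have k0 := lt_knot j0; rewrite knot0 in k0.
  have k1 := lt_knot (ltnSn j').
  have : knot j' * knot j' <= (knot j' + knot j'.+1) * (1 - z.1) - knot j' * knot j'.+1.
    have : 0 <= (knot j' + knot j'.+1) * ((1 - z.1) - knot j').
      by apply: mulr_ge0; lra.
    nra.
  by move=> kk; exfalso; have := mulr_gt0 k0 k0; lra.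
- rewrite !ltnS !eqSS => jm ij' nij nji.
  have im : (i' < m)%N by apply: leq_trans ij' _.
  rewrite im; case: ltnP => jm'.
    have ij2 : (i'.+1 < j')%N.
      by rewrite ltn_neqAle ij' andbT; move: nij; rewrite (ltn_eqF im) eqSS eq_sym.
    move=> [z1 _ _] [_ z2 _]; exfalso; have := lt_knot ij2; lra.
  have {}jm' : j' = m by apply/eqP; rewrite eqn_leq jm.
  rewrite jm' (ltn_eqF im) eqSS eqxx /= in nij nji.
  have i2 : (i'.+1 < m)%N by rewrite ltn_neqAle im andbT; rewrite eq_sym.
  move=> [z1 _ _] [z0 _ _]; exfalso; have := lt_knot i2; rewrite knotm; lra.
Qed.

Lemma dent_simple : simple_polygon dent_vertex.
Proof. by split; [exact: dent_noncollinear|exact: dent_edges_disjoint]. Qed.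

(** The deviation from the parabola in factored form, which reduces comparing chords to the signs of
    two products. *)
Lemma chordE j x : chord j x =
  (1 - x) ^+ 2 - ((1 - x) - knot j) * ((1 - x) - knot j.+1).
Proof. by rewrite /chord; ring. Qed.

Lemma knot_between (w : R) : 0 <= w -> w <= 1 ->
  exists2 l, (l < m)%N & knot l <= w /\ w <= knot l.+1.
Proof.
move=> w0; rewrite -knotm => wm.
suff: forall k, (0 < k)%N -> (k <= m)%N -> w <= knot k ->
    exists2 l, (l < m)%N & knot l <= w /\ w <= knot l.+1 by apply; eauto.
elim=> // k IHk _ km wk.
have [k0|k0] := posnP k; first by subst k; exists 0%N; rewrite // knot0.
have [wk'|wk'] := leP w (knot k); last by exists k => //; split=> //; apply: ltW.
by have [l lm lw] := IHk k0 (ltnW km) wk'; exists l.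
Qed.

(** Over its own interval the chord [l] is on or above the parabola, and every other chord is on or
    below it. *)
Lemma chord_le j l x : knot l <= 1 - x -> 1 - x <= knot l.+1 ->
  chord j x <= chord l x.
Proof.
move=> xl xl'; have [jl|lj|->//] := ltngtP j l.
- have := le_knot (jl : (j.+1 <= l)%N); have := lt_knot (ltnSn j) => k1 k2.
  rewrite !chordE; have : 0 <= (1 - x - knot j) * (1 - x - knot j.+1).
    by apply: mulr_ge0; lra.
  have : 0 <= (1 - x - knot l) * (knot l.+1 - (1 - x)) by apply: mulr_ge0; lra.
  lra.
- have := le_knot (lj : (l.+1 <= j)%N); have := lt_knot (ltnSn j) => k1 k2.
  rewrite !chordE; have : 0 <= (knot j - (1 - x)) * (knot j.+1 - (1 - x)).
    by apply: mulr_ge0; lra.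
  have : 0 <= (1 - x - knot l) * (knot l.+1 - (1 - x)) by apply: mulr_ge0; lra.
  lra.
Qed.

Lemma chord_bound j x : (j < m)%N -> 0 <= x -> 0 <= chord j x ->
  x <= 1 /\ chord j x <= 1 - x.
Proof.
move=> jm x0; have k0 := knot_ge0 j; have k1 := lt_knot (ltnSn j).
have k2 := knot_le1 jm; rewrite /chord => c0.
have kk : 0 <= knot j * knot j.+1 by apply: mulr_ge0; lra.
have x1 : x <= 1.
  rewrite leNgt; apply/negP => x1.
  have : 0 < (knot j + knot j.+1) * (x - 1) by apply: mulr_gt0; lra.
  lra.
split=> //.
(* This product and the next one add up to [1 - x - chord j x]. *)
have : 0 <= (1 - x) * ((1 - knot j) * (1 - knot j.+1)).
  by apply: mulr_ge0; [lra|apply: mulr_ge0; lra].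
have : 0 <= x * (knot j * knot j.+1) by apply: mulr_ge0.
lra.
Qed.

(** A finite combination of half-planes, so that closedness and measurability come from those of
    half-planes. *)
Definition dent_region : set (R * R) :=
  [set z | 0 <= z.1] `&` [set z | 0 <= z.2] `&`
  \bigcup_(j in `I_m) [set z | z.2 <= chord j z.1].

Definition dent_interior : set (R * R) :=
  [set z | 0 < z.1] `&` [set z | 0 < z.2] `&`
  \bigcup_(j in `I_m) [set z | z.2 < chord j z.1].

Local Notation curve := (polygon_curve dent_vertex).

Lemma curveP z : curve z <-> exists2 k, (k < m.+2)%N & dent_edge k z.
Proof.
split=> [[i _ /dent_edgeP iz]|[k km kz]]; first by exists (val i) => //; apply: ltn_ord.
by exists (Ordinal km) => //; apply/dent_edgeP.
Qed.

Lemma chord0_ge0 x : x <= 1 -> 0 <= chord 0 x.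
Proof.
move=> x1; rewrite /chord knot0 mul0r subr0 add0r mulr_ge0 //; last lra.
exact: knot_ge0.
Qed.

Lemma chord_last j : j.+1 = m -> chord j 0 = 1.
Proof. by move=> jm; rewrite /chord jm knotm; lra. Qed.

Lemma curve_sub_region : curve `<=` dent_region.
Proof.
move=> z /curveP[[|j] km] /=.
  move=> [z2 z0 z1]; split; first by split; rewrite /= ?z2.
  by exists 0%N => //=; rewrite z2 chord0_ge0.
case: ltnP => jm [].
  move=> z1 z1' z2; have x1 := knot_le1 jm; have x0 := knot_ge0 j.
  have zc : 0 <= chord j z.1.
    rewrite /chord; have := lt_knot (ltnSn j) => k1.
    have : 0 <= knot j * ((1 - z.1) - knot j) by apply: mulr_ge0; lra.
    have : 0 <= knot j.+1 * ((1 - z.1) - knot j) by apply: mulr_ge0; lra.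
    have := mulr_ge0 x0 x0; lra.
  split; last by exists j => //=; rewrite z2.
  by split=> /=; [lra|rewrite z2].
move=> z1 z2 z2'; split; first by split; rewrite /= ?z1.
have mE : m.-1.+1 = m by rewrite prednK.
by exists m.-1 => /=; [rewrite prednK|rewrite z1 chord_last].
Qed.

Lemma region_sub_curve : dent_region `<=` dent_interior `|` curve.
Proof.
move=> z [[/= z1 z2] [j /= jm zj]].
have cj0 : 0 <= chord j z.1 by apply: le_trans zj.
have [x1 cj1] := chord_bound jm z1 cj0.
have [zx|zx] := eqVneq z.1 0.
  right; apply/curveP; exists m.+1 => //=; rewrite ltnn; split => //.
  by rewrite zx in cj1 zj; lra.
have [zy|zy] := eqVneq z.2 0; first by right; apply/curveP; exists 0%N.
have [[l lm zl]|none] := pselect (exists2 l, (l < m)%N & z.2 < chord l z.1).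
  left; split; last by exists l.
  by split; rewrite /= lt_neqAle ?z1 ?z2 andbT eq_sym.
right; apply/curveP.
have [||l lm [wl wl']] := @knot_between (1 - z.1); [lra|lra|].
exists l.+1; first by rewrite ltnS (ltn_trans lm).
rewrite /= lm; split; [lra|lra|apply/eqP; rewrite eq_le].
rewrite (le_trans zj (chord_le j wl wl')) leNgt.
by apply/negP => zl; apply: none; exists l.
Qed.

(** * Topology and measurability of the region *)

Lemma continuous_affine (a b c : R) :
  continuous (fun z : R * R => a * z.1 + b * z.2 + c).
Proof.
move=> z; apply: cvgD; last exact: cvg_cst.
by apply: cvgD; apply: cvgM; (try exact: cvg_cst); [exact: cvg_fst|exact: cvg_snd].
Qed.

Lemma measurable_affine (a b c : R) :
  measurable_fun setT (fun z : R * R => a * z.1 + b * z.2 + c).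
Proof.
apply: measurable_funD; last exact: measurable_cst.
by apply: measurable_funD; apply: measurable_funM; (try exact: measurable_cst);
  [exact: measurable_fst|exact: measurable_snd].
Qed.

Lemma open_halfplane (a b c : R) : open [set z : R * R | 0 < a * z.1 + b * z.2 + c].
Proof.
apply: (@open_comp _ _ (fun z : R * R => a * z.1 + b * z.2 + c) [set t | 0 < t]).
  by move=> z _; apply: continuous_affine.
exact: open_gt.
Qed.

Lemma closed_halfplane (a b c : R) : closed [set z : R * R | 0 <= a * z.1 + b * z.2 + c].
Proof.
apply: (@preimage_closed _ _ (fun z : R * R => a * z.1 + b * z.2 + c) [set t | 0 <= t]).
  by move=> z _; apply: continuous_affine.
exact: closed_ge.
Qed.

Lemma measurable_halfplane (a b c : R) :
  measurable [set z : R * R | 0 <= a * z.1 + b * z.2 + c].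
Proof.
rewrite -[X in measurable X]setTI; apply: measurable_fun_le => //.
exact: measurable_affine.
Qed.

Let affine1 (z : R * R) : z.1 = 1 * z.1 + 0 * z.2 + 0. Proof. ring. Qed.
Let affine2 (z : R * R) : z.2 = 0 * z.1 + 1 * z.2 + 0. Proof. ring. Qed.
Let affine_chord j (z : R * R) : chord j z.1 - z.2 =
  - (knot j + knot j.+1) * z.1 + (-1) * z.2 + (knot j + knot j.+1 - knot j * knot j.+1).
Proof. rewrite /chord; ring. Qed.

Lemma open_dent_interior : open dent_interior.
Proof.
apply: openI; first apply: openI.
- by under eq_set => z do rewrite (affine1 z); apply: open_halfplane.
- by under eq_set => z do rewrite (affine2 z); apply: open_halfplane.
apply: bigcup_open => j _.
by under eq_set => z do rewrite -subr_gt0 affine_chord; apply: open_halfplane.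
Qed.

Lemma closed_dent_region : closed dent_region.
Proof.
apply: closedI; first apply: closedI.
- by under eq_set => z do rewrite (affine1 z); apply: closed_halfplane.
- by under eq_set => z do rewrite (affine2 z); apply: closed_halfplane.
apply: closed_bigcup => [|j _]; first exact: finite_II.
by under eq_set => z do rewrite -subr_ge0 affine_chord; apply: closed_halfplane.
Qed.

Lemma measurable_dent_region : measurable dent_region.
Proof.
apply: measurableI; first apply: measurableI.
- by under eq_set => z do rewrite (affine1 z); apply: measurable_halfplane.
- by under eq_set => z do rewrite (affine2 z); apply: measurable_halfplane.
apply: bigcup_measurable => j _.
by under eq_set => z do rewrite -subr_ge0 affine_chord; apply: measurable_halfplane.
Qed.

Lemma dent_interior_sub : dent_interior `<=` dent_region.
Proof.
move=> z [[z1 z2] [j jm zj]]; split; last by exists j => //; apply: ltW.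
by split; apply: ltW.
Qed.

Lemma dent_region_triangle z : dent_region z -> [/\ 0 <= z.1, 0 <= z.2 & z.1 + z.2 <= 1].
Proof.
move=> [[/= z1 z2] [j /= jm zj]]; split=> //.
have [] := chord_bound jm z1 (le_trans z2 zj); lra.
Qed.

Lemma dent_component_bounded z : dent_interior z -> ~ curve z ->
  bounded_set (connected_component (~` curve) z).
Proof.
move=> zi zc; set C := connected_component _ _.
have Cz : C z by apply: connected_component_refl.
(* The interior is open, and off the curve it coincides with the closed region; so it cuts out a
   relatively clopen part of the component. *)
have CI : C `&` dent_interior = C.
  apply: (@component_connected _ (~` curve) z).
  - by exists z.
  - by exists dent_interior => //; apply: open_dent_interior.
  - exists dent_region; first exact: closed_dent_region.
    apply/seteqP; split=> x [Cx xD]; split=> //; first exact: dent_interior_sub.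
    have [//|xc] := region_sub_curve xD.
    by have := connected_component_sub Cx.
exists 1; split=> // M M1 x /=; rewrite -CI => -[_ /dent_interior_sub].
move=> /dent_region_triangle[x1 x2 x3]; rewrite prod_normE ge_max !ger0_norm //.
by apply/andP; split; lra.
Qed.

Lemma unbounded_ray (A : set (R * R)) (z e : R * R) : e != 0 ->
  (forall t, 0 <= t -> A (z + t *: e)) -> ~ bounded_set (connected_component A z).
Proof.
move=> e0 ray [M0 [_ /(_ (M0 + 1))]]; rewrite ltrDl ltr01 => /(_ isT) MC.
set M := M0 + 1 in MC.
have zr : [set z + t *: e | t in `[0, +oo[] z.
  by exists 0; rewrite /= ?in_itv /= ?lexx // scale0r addr0.
have sub : [set z + t *: e | t in `[0, +oo[] `<=` connected_component A z.
  apply: (connected_component_max zr).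
    by move=> x [t /=]; rewrite in_itv /= andbT => t0 <-; apply: ray.
  apply: connected_continuous_connected.
    exact/connected_intervalP/interval_is_interval.
  apply: continuous_subspaceT.
  have cz : continuous (fun _ : R => z) by move=> t; apply: cvg_cst.
  by move=> t; exact: (cvgD (cz t) (@scalel_continuous _ _ e t)).
have ne : 0 < `|e| by rewrite normr_gt0.
(* Chosen so that [t *: e] has norm [|M| + |z| + 1], whence [z + t *: e] has norm greater than
   [M]. *)
pose t := (`|M| + `|z| + 1) / `|e|.
have t0 : 0 <= t by rewrite divr_ge0 // addr_ge0 // addr_ge0.
have zM : `|z + t *: e| <= M.
  by apply: MC; apply: sub; exists t => //=; rewrite in_itv /= t0.
have tE : `|t *: e| = `|M| + `|z| + 1.
  by rewrite normrZ (ger0_norm t0) divfK ?gt_eqF.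
have := lerB_normD (t *: e) z; rewrite (addrC (t *: e)) tE.
have := ler_norm M; lra.
Qed.

Lemma filled_dentE : filled_polygon dent_vertex = dent_region.
Proof.
apply/seteqP; split => z.
  move=> [/curve_sub_region//|[zc bC]]; apply: contrapT => zD.
  (* From every point outside the region, the ray to the left, downwards or upwards avoids the
     region, hence the curve. *)
  have off e : e != 0 -> (forall t, 0 <= t -> ~ dent_region (z + t *: e)) -> False.
    move=> e0 eD; apply: unbounded_ray bC => // [|t t0 /curve_sub_region]; [exact: e0|].
    exact: eD.
  have [z1|z1] := ltP z.1 0.
    apply: (off (-1, 0)) => [|t t0 /dent_region_triangle[]].
      by rewrite xpair_eqE oppr_eq0 oner_eq0.
    by rewrite /= /GRing.scale /=; lra.
  have [z2|z2] := ltP z.2 0.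
    apply: (off (0, -1)) => [|t t0 /dent_region_triangle[]].
      by rewrite xpair_eqE oppr_eq0 oner_eq0 andbF.
    by rewrite /= /GRing.scale /=; lra.
  apply: (off (0, 1)) => [|t t0 [_ [j jm]]].
    by rewrite xpair_eqE oner_eq0 andbF.
  rewrite /= /GRing.scale /= mulr0 addr0 mulr1 => zj.
  by apply: zD; split => //; exists j => //=; lra.
move=> /region_sub_curve[zi|zc]; last by left.
by have [zc|zc] := pselect (curve z); [left|right; split=> //; apply: dent_component_bounded].
Qed.

Lemma dent_region_hleg t : 0 <= t -> t <= 1 -> dent_region (t, 0).
Proof. by move=> t0 t1; apply: curve_sub_region; apply/curveP; exists 0%N. Qed.

Lemma dent_region_vleg t : 0 <= t -> t <= 1 -> dent_region (0, t).
Proof.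
by move=> t0 t1; apply: curve_sub_region; apply/curveP; exists m.+1 => //=; rewrite ltnn.
Qed.

Lemma dent_region_square (z : R * R) :
  0 <= z.1 -> z.1 <= 4^-1 -> 0 <= z.2 -> z.2 <= 4^-1 -> dent_region z.
Proof.
move=> z1 z1' z2 z2'; split; first by split.
(* The last chord starts at [(0, 1)] with slope at least -2, so it is still at height at least 1/2
   at abscissa 1/4. *)
have mE : m.-1.+1 = m by rewrite prednK.
exists m.-1 => /=; first by rewrite prednK.
rewrite /chord mE knotm; have := knot_ge0 m.-1; have := @knot_le1 m.-1 (leq_pred m).
nra.
Qed.

End Dented.

(** * Areas of homothetic copies *)

Section Area.
Variable R : realType.

Lemma area_rect (a b c d : R) : a <= b -> c <= d ->
  area (`[a, b] `*` `[c, d]) = ((b - a) * (d - c))%:E.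
Proof.
move=> ab cd; rewrite /area product_measure1E //.
have itvE (x y : R) : x <= y -> (@lebesgue_measure R) `[x, y] = (y - x)%:E.
  move=> xy; rewrite lebesgue_measure_itv /= lte_fin.
  by case: ltP => // yx; rewrite (@le_anti _ _ x y) ?xy // subrr.
by apply: etrans (congr2 mule (itvE _ _ ab) (itvE _ _ cd)) _; rewrite EFinM.
Qed.

Lemma areaU2 (A B : set (R * R)) : measurable A -> measurable B ->
  (area (A `|` B) <= area A + area B)%E.
Proof. exact: (measureU2 ((@lebesgue_measure R) \x (@lebesgue_measure R))%E). Qed.

Definition homothet (S : set (R * R)) (s : R) (c : R * R) : set (R * R) :=
  [set s *: z + c | z in S].

Variable S : set (R * R).
Hypothesis mS : measurable S.
Hypothesis S_triangle : forall z, S z -> [/\ 0 <= z.1, 0 <= z.2 & z.1 + z.2 <= 1].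
Hypothesis S_square : forall z : R * R,
  0 <= z.1 -> z.1 <= 4^-1 -> 0 <= z.2 -> z.2 <= 4^-1 -> S z.

Lemma homothetE s c : 0 < s ->
  homothet S s c = [set z | S (s^-1 * (z.1 - c.1), s^-1 * (z.2 - c.2))].
Proof.
move=> s0; have sV : s^-1 * s = 1 by rewrite mulVf ?gt_eqF.
apply/seteqP; split=> [_ [[x y] Sz <-]|[x y] /= Sz].
  by rewrite /= /GRing.scale /= !addrK !mulrA sV !mul1r.
exists (s^-1 * (x - c.1), s^-1 * (y - c.2)) => //.
case: c {Sz} => a b /=.
rewrite (_ : s *: _ = (s * (s^-1 * (x - a)), s * (s^-1 * (y - b)))) //.
by rewrite !mulrA mulfV ?gt_eqF // !mul1r; congr pair; rewrite subrK.
Qed.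

Lemma measurable_homothet s c : 0 < s -> measurable (homothet S s c).
Proof.
move=> s0; rewrite homothetE // -[X in measurable X]setTI.
have mg : measurable_fun setT (fun z : R * R => (s^-1 * (z.1 - c.1), s^-1 * (z.2 - c.2))).
  apply: measurable_fun_pair; apply: measurable_funM; (try exact: measurable_cst);
  apply: measurable_funB; (try exact: measurable_cst);
  [exact: measurable_fst|exact: measurable_snd].
by have := mg measurableT S mS.
Qed.

Lemma homothet_triangle s c z : 0 < s -> homothet S s c z ->
  [/\ c.1 <= z.1, c.2 <= z.2 & z.1 + z.2 <= c.1 + c.2 + s].
Proof.
move=> s0 [w /S_triangle[w1 w2 w3] <-]; rewrite /= /GRing.scale /=.
have := mulr_ge0 (ltW s0) w1; have := mulr_ge0 (ltW s0) w2.
have := ler_wpM2l (ltW s0) w3; rewrite mulr1 mulrDr.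
by move=> *; split; lra.
Qed.

Lemma area_homothet_ge s c : 0 < s -> ((s ^+ 2 / 16)%:E <= area (homothet S s c))%E.
Proof.
move=> s0; have s4 : 0 <= s / 4 by lra.
have -> : s ^+ 2 / 16 = (c.1 + s / 4 - c.1) * (c.2 + s / 4 - c.2).
  by field.
rewrite -area_rect; [|lra|lra].
apply: le_measure; rewrite ?inE; [|exact: measurable_homothet|].
  by apply: measurableX.
move=> [x y] /=; rewrite !in_itv /= => -[/andP[x1 x2] /andP[y1 y2]].
rewrite homothetE //=; apply: S_square => /=.
- by apply: mulr_ge0; [rewrite invr_ge0 ltW|lra].
- by rewrite mulrC ler_pdivrMr //; lra.
- by apply: mulr_ge0; [rewrite invr_ge0 ltW|lra].
- by rewrite mulrC ler_pdivrMr //; lra.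
Qed.

(* Outside the box, the copy lies in four strips along the sides of its bounding square,
   while it contains a square of side [s / 4]. *)
Lemma homothet_free (s alpha th x1 x2 y1 y2 : R) (c : R * R) (U : set (R * R)) :
  0 < s -> measurable U -> alpha <= 1 -> 16 * th <= 1 - alpha ->
  c.1 <= x1 -> x1 <= c.1 + s -> c.1 <= x2 -> x2 <= c.1 + s ->
  c.2 <= y1 -> y1 <= c.2 + s -> c.2 <= y2 -> y2 <= c.2 + s ->
  (x1 - c.1) + (c.1 + s - x2) + (y1 - c.2) + (c.2 + s - y2) <= th * s ->
  (forall z, homothet S s c z -> x1 < z.1 < x2 -> y1 < z.2 < y2 -> ~ U z) ->
  (alpha%:E * area (homothet S s c) <= area (homothet S s c `\` U))%E.
Proof.
move=> s0 mU a1 tha x1a x1b x2a x2b y1a y1b y2a y2b cut free.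
set F := homothet S s c; have mF : measurable F by apply: measurable_homothet.
pose Q1 : set (R * R) := `[c.1, x1] `*` `[c.2, c.2 + s].
pose Q2 : set (R * R) := `[x2, c.1 + s] `*` `[c.2, c.2 + s].
pose Q3 : set (R * R) := `[c.1, c.1 + s] `*` `[c.2, y1].
pose Q4 : set (R * R) := `[c.1, c.1 + s] `*` `[y2, c.2 + s].
have mQ1 : measurable Q1 by apply: measurableX.
have mQ2 : measurable Q2 by apply: measurableX.
have mQ3 : measurable Q3 by apply: measurableX.
have mQ4 : measurable Q4 by apply: measurableX.
have box z : F z -> [/\ c.1 <= z.1, z.1 <= c.1 + s, c.2 <= z.2 & z.2 <= c.2 + s].
  by move=> /(homothet_triangle s0)[? ? ?]; split; lra.
have cover : F `<=` (F `\` U) `|` (Q1 `|` Q2 `|` (Q3 `|` Q4)).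
  move=> z Fz; have [z1 z2 z3 z4] := box z Fz.
  rewrite /Q1 /Q2 /Q3 /Q4 /= !in_itv /= z1 z2 z3 z4 /=.
  case: (leP z.1 x1) => c1; first by right; left; left.
  case: (leP x2 z.1) => c2; first by right; left; right.
  case: (leP z.2 y1) => c3; first by right; right; left.
  case: (leP y2 z.2) => c4; first by right; right; right.
  by left; split => //; apply: free; rewrite ?c1 ?c3.
have mFU : measurable (F `\` U) by apply: measurableD.
have aF : (area F <= area (F `\` U) + (th * s ^+ 2)%:E)%E.
  apply: (@le_trans _ _ (area ((F `\` U) `|` (Q1 `|` Q2 `|` (Q3 `|` Q4))))).
    apply: le_measure; rewrite ?inE //; apply: measurableU => //.
    by apply: measurableU; apply: measurableU.
  apply: le_trans (areaU2 _ _) _ => //; first by apply: measurableU; apply: measurableU.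
  rewrite leeD2l //; apply: le_trans (areaU2 _ _) _; try exact: measurableU.
  apply: le_trans (leeD (areaU2 mQ1 mQ2) (areaU2 mQ3 mQ4)) _.
  have c1s : c.1 <= c.1 + s by lra. have c2s : c.2 <= c.2 + s by lra.
  rewrite !area_rect // -!EFinD lee_fin.
  have := ler_wpM2r (ltW s0) cut; lra.
have fF : area F \is a fin_num.
  rewrite ge0_fin_numE; last exact: measure_ge0.
  apply: (@le_lt_trans _ _ (area (`[c.1, c.1 + s] `*` `[c.2, c.2 + s]))).
    apply: le_measure; rewrite ?inE //; first exact: measurableX.
    by move=> z /box[? ? ? ?]; rewrite /= !in_itv /=; split; apply/andP.
  by rewrite area_rect ?lerDl ?ltW // ltry.
have aFge := area_homothet_ge c s0; rewrite -/F in aFge.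
case: (area F) fF aF aFge => // a _; rewrite lee_fin => aF aFge.
have fFU : area (F `\` U) \is a fin_num \/ area (F `\` U) = +oo%E.
  by have : (0 <= area (F `\` U))%E by []; case: (area _) => //; [left|right].
case: fFU => [|->]; last by rewrite leey.
case: (area _) aF => // b; rewrite -EFinD -EFinM !lee_fin => aF _.
(* The area [a] of the copy is at least [s ^ 2 / 16], so the loss, at most [th * s ^ 2], does not
   exceed [(1 - alpha) * a]. *)
have : 0 <= (1 - alpha) * (a - s ^+ 2 / 16) by apply: mulr_ge0; lra.
have : 0 <= (1 - alpha - 16 * th) * s ^+ 2.
  by apply: mulr_ge0; [lra|rewrite exprn_ge0 // ltW].
lra.
Qed.

End Area.

(** * The arrangement in integer coordinates *)

(* A piece stands for a right triangle with legs on its left and at its bottom. [Hub h i]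
   is hub [i] of row [h]. Line [k] of the bundle [(h, i)] climbs from row [h - 1] to the
   right tip of [Hub h i]: first vertically, then to the right, then up and to the left,
   [j] numbering the pieces of each part ([Diag] from the hub downwards). *)
Inductive piece : Type :=
  | Wall
  | Hub of nat & nat
  | Vert of nat & nat & nat & nat
  | Horiz of nat & nat & nat & nat
  | Diag of nat & nat & nat & nat.

Definition piece_code (v : piece) : nat * (nat * nat * nat * nat) :=
  match v with
  | Wall => (0, (0, 0, 0, 0))
  | Hub h i => (1, (h, i, 0, 0))
  | Vert h i k j => (2, (h, i, k, j))
  | Horiz h i k j => (3, (h, i, k, j))
  | Diag h i k j => (4, (h, i, k, j))
  end.

Definition piece_decode (c : nat * (nat * nat * nat * nat)) : piece :=
  let: (p, (h, i, k, j)) := c in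
  match p with
  | 0 => Wall | 1 => Hub h i | 2 => Vert h i k j | 3 => Horiz h i k j | _ => Diag h i k j
  end.

Lemma piece_codeK : cancel piece_code piece_decode.
Proof. by case. Qed.

HB.instance Definition _ := Countable.copy piece (can_type piece_codeK).

Section Arrangement.
Variables (N K M R : nat).
Hypothesis N_ge2 : (2 <= N)%N.

(* Each piece loses at most the fraction [1 / N] of its size to the others. Line [k] pokes
   through a tip at distance [offset k] from its end with a piece of size [thick k], whose
   top is met, [gap k] below the hypotenuse of the hub, by a piece of size [thin k]. The
   scales of consecutive lines differ by the factor [W], and all ratios are integers. *)
Let W := (4 * N ^ 2)%N.
Definition gap (k : nat) : nat := (W ^ (K - k.+1))%N.
Definition thin (k : nat) : nat := (N * gap k)%N.
Definition offset (k : nat) : nat := (2 * thin k)%N.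
Definition thick (k : nat) : nat := (N * offset k)%N.
Definition unit_len : nat := (W ^ K)%N.
Definition num_vert (k : nat) : nat := (8 * N * W ^ k)%N.
Definition num_horiz (k : nat) : nat := (4 * N * W ^ k - 2 * N)%N.
Definition num_diag (k : nat) : nat := (2 * W ^ k)%N.

Let W_gt0 : (0 < W)%N.
Proof. rewrite muln_gt0 expn_gt0; lia. Qed.

Lemma unit_lenE k : (k < K)%N -> unit_len = (W ^ k.+1 * gap k)%N.
Proof. by move=> kK; rewrite /unit_len /gap -expnD; congr expn; lia. Qed.

(** Rows are [3 * unit_len] apart: the vertical part climbs two thirds of this, the diagonal part
    the rest. *)
Lemma num_vertE k : (k < K)%N -> (num_vert k * thin k = 2 * unit_len)%N.
Proof.
move=> kK; rewrite (unit_lenE kK) /num_vert /thin expnS.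
by set w := (W ^ k)%N; rewrite /W; ring.
Qed.

Lemma num_diagE k : (k < K)%N -> (num_diag k * thick k = unit_len)%N.
Proof.
move=> kK; rewrite (unit_lenE kK) /num_diag /thick /offset /thin expnS.
by set w := (W ^ k)%N; rewrite /W; ring.
Qed.

(** The horizontal part ends where the last [Diag], of width [thick k], begins. *)
Lemma num_horizE k : (k < K)%N -> (num_horiz k * thin k + thick k = unit_len)%N.
Proof.
move=> kK; rewrite (unit_lenE kK) /num_horiz /thick /offset /thin expnS.
have : (0 < W ^ k)%N by rewrite expn_gt0 W_gt0.
set w := (W ^ k)%N => w0; rewrite /W; nia.
Qed.

Lemma gap_step k : (k.+1 < K)%N -> gap k = (W * gap k.+1)%N.
Proof. by move=> kK; rewrite /gap -expnS; congr expn; lia. Qed.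

Lemma gap_gt0 k : (0 < gap k)%N.
Proof. by rewrite expn_gt0 W_gt0. Qed.

Lemma line_facts k : (k < K)%N ->
  [/\ (1 <= gap k)%N, (2 * gap k <= thin k)%N, offset k = (2 * thin k)%N &
      (2 * offset k <= thick k)%N /\ (2 * thick k <= unit_len)%N].
Proof.
move=> kK; have s0 := gap_gt0 k; split=> //; first by rewrite leq_mul2r N_ge2 orbT.
split; first by rewrite leq_mul2r N_ge2 orbT.
by rewrite -(num_diagE kK) leq_mul2r leq_pmulr ?orbT // expn_gt0 W_gt0.
Qed.

(** The diagonal strip of a finer line fits into the gap that line [k] leaves below the hypotenuse
    of the hub, since [gap + thick] is [(2 N ^ 2 + 1) * gap] while [W] is [4 N ^ 2]. *)
Lemma line_nested k l : (k < l)%N -> (l < K)%N -> (gap l + thick l < gap k)%N.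
Proof.
elim: l => // l IHl; rewrite ltnS leq_eqVlt => /orP[/eqP ->|kl] lK.
  rewrite (gap_step lK) /thick /offset /thin; have := gap_gt0 l.+1.
  by set s := gap _; rewrite /W => s0; nia.
apply: ltn_trans (IHl kl (ltnW lK)).
rewrite /thick /offset /thin (gap_step lK); have := gap_gt0 l.+1.
by set s := gap _; rewrite /W => s0; nia.
Qed.

Lemma offset_le0 k : (k < K)%N -> (offset k <= offset 0)%N.
Proof.
case: (posnP k) => [->//|k0] kK; have := line_nested k0 kK.
have [_ _ _ [? _]] := line_facts kK; have [? ? ? _] := line_facts (leq_ltn_trans (leq0n k) kK).
lia.
Qed.

Local Notation "n '%:i'" := (Posz n) (at level 2, format "n '%:i'").

(** At distance [offset k] to the left of its tip, the triangle around a hub is [offset k] high. The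
    first [Diag] of line [k] has its apex there, [gap k] below the hypotenuse, and the apex is also
    the lower left corner of the first [Vert] towards the next row. The hypotenuses of all [Diag]
    pieces of the line lie on one line, which passes [gap k] to the left of the tip and so misses
    the next hub. *)
Definition left_of (v : piece) : int :=
  match v with
  | Wall => (R.+1 * (2 * unit_len))%N%:i
  | Hub h i => (i * (2 * unit_len))%N%:i
  | Vert h i k j => (i.+1 * (2 * unit_len))%N%:i - (offset k)%:i
  | Horiz h i k j => (i.+1 * (2 * unit_len))%N%:i - (offset k)%:i + (j * thin k)%N%:i
  | Diag h i k j => (i.+1 * (2 * unit_len))%N%:i - (offset k)%:i + (j * thick k)%N%:i
  end.

Definition bottom_of (v : piece) : int :=
  match v with
  | Wall => -1
  | Hub h i => (h * (3 * unit_len))%N%:i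
  | Vert h i k j => (h * (3 * unit_len))%N%:i - (3 * unit_len)%N%:i
      + (offset k)%:i - (gap k)%:i + (j * thin k)%N%:i
  | Horiz h i k j => (h * (3 * unit_len))%N%:i + (offset k)%:i - (gap k)%:i - unit_len%:i
  | Diag h i k j => (h * (3 * unit_len))%N%:i
      + (offset k)%:i - (gap k)%:i - (j.+1 * thick k)%N%:i
  end.

Definition size_of (v : piece) : nat :=
  match v with
  | Wall => (M * (3 * unit_len)).+1
  | Hub h i => (2 * unit_len)%N
  | Vert h i k j | Horiz h i k j => thin k
  | Diag h i k j => thick k
  end.

(* Overlaps occur only at the right tip of a hub, at the lower left corner of the first
   [Vert] of a line (with the hub below) and at the top of its first [Diag] (with the hub
   it pokes through); what remains of a piece between these bounds is covered by no other. *)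
Definition free_left (v : piece) : int :=
  if v is Vert h i k 0 then left_of v + (gap k)%:i else left_of v.

Definition free_right (v : piece) : int :=
  if v is Hub h i then left_of v + (size_of v)%:i - (offset 0)%:i
  else left_of v + (size_of v)%:i.

Definition free_top (v : piece) : int :=
  if v is Diag h i k 0 then (h * (3 * unit_len))%N%:i else bottom_of v + (size_of v)%:i.

Definition valid (v : piece) : bool :=
  match v with
  | Wall => true
  | Hub h i => (h < M)%N && (i < R.+1)%N
  | Vert h i k j => [&& h < M, i < R, k < K & j < num_vert k]%N
  | Horiz h i k j => [&& h < M, i < R, k < K & j < num_horiz k]%N
  | Diag h i k j => [&& h < M, i < R, k < K & j < num_diag k]%N
  end.

Definition hyp_of (v : piece) : int := left_of v + bottom_of v + (size_of v)%:i.

(* Sufficient for the free part of [v] to miss [u]; the last two clauses separate them by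
   a line parallel to the hypotenuses. *)
Definition separated (v u : piece) : Prop :=
  [\/ free_right v <= left_of u, left_of u + (size_of u)%:i <= free_left v,
      free_top v <= bottom_of u | bottom_of u + (size_of u)%:i <= bottom_of v] \/
  (hyp_of u <= free_left v + bottom_of v \/ hyp_of v < left_of u + bottom_of u).

(** Products of two variables are atoms for [lia]; facts about them are supplied in this form. *)
Lemma mulz_mono (a b c : nat) : (a < b)%N -> (a * c)%N%:i + c%:i <= (b * c)%N%:i.
Proof. by move=> ab; have := leq_mul2r c a.+1 b; rewrite ab orbT mulSn; lia. Qed.

Lemma mulz_le (a b c : nat) : (a <= b)%N -> (a * c)%N%:i <= (b * c)%N%:i.
Proof. by move=> ab; rewrite lez_nat leq_mul2r ab orbT. Qed.

Lemma count_mul (a b c : nat) : (a < b)%N -> (a * c + c <= b * c)%N.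
Proof. by move=> ab; rewrite -mulSnr leq_mul2r ab orbT. Qed.

(** * Separation of any two pieces *)

Definition line_of (v : piece) : option (nat * nat * nat) :=
  match v with
  | Wall | Hub _ _ => None
  | Vert h i k _ | Horiz h i k _ | Diag h i k _ => Some (h, i, k)
  end.

Lemma free_box v : valid v ->
  [/\ left_of v <= free_left v, free_right v <= left_of v + (size_of v)%:i &
      free_top v <= bottom_of v + (size_of v)%:i].
Proof.
case: v => [|h i|h i k [|j]|h i k j|h i k [|j]] //=;
  rewrite /free_right /free_left /free_top /=; try by split; lia.
case/and4P=> _ _ kK _; have [? ? ? [? ?]] := line_facts kK.
by split; lia.
Qed.

(** A bounding box of the whole line, enough to separate lines whose bundles are neither equal nor
    consecutive in a column. *)
Lemma line_box v h i k : valid v -> line_of v = Some (h, i, k) ->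
  [/\ (h < M)%N, (i < R)%N & (k < K)%N] /\
  [/\ (i.+1 * (2 * unit_len))%N%:i - (offset k)%:i <= left_of v,
      left_of v + (size_of v)%:i <= (i.+1 * (2 * unit_len))%N%:i + unit_len%:i,
      (h * (3 * unit_len))%N%:i - (3 * unit_len)%N%:i + (offset k)%:i - (gap k)%:i
        <= bottom_of v &
      bottom_of v + (size_of v)%:i
        <= (h * (3 * unit_len))%N%:i + (offset k)%:i - (gap k)%:i].
Proof.
case: v => //= h' i' k' j /and4P[hM iR kK jn] [<- <- <-]; (split; first by split);
have [? ? ? [? ?]] := line_facts kK; have := count_mul (_ k') jn.
- by move=> /(_ thin); rewrite num_vertE // => ?; split; lia.
- by move=> /(_ thin) ?; have := num_horizE kK; split; lia.
- by move=> /(_ thick); rewrite num_diagE // => ?; split; lia.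
Qed.

Lemma separated_Hub_Hub h i h' i' : Hub h i <> Hub h' i' -> separated (Hub h i) (Hub h' i').
Proof.
move=> ne; left; rewrite /free_right /free_left /free_top /=.
have [lt|lt|eqi] := ltngtP i i'.
- by constructor 1; have := mulz_mono (2 * unit_len) lt; lia.
- by constructor 2; have := mulz_mono (2 * unit_len) lt; lia.
have [lt|lt|eqh] := ltngtP h h'.
- by constructor 3; have := mulz_mono (3 * unit_len) lt; lia.
- by constructor 4; have := mulz_mono (3 * unit_len) lt; lia.
by case: ne; rewrite eqi eqh.
Qed.

Lemma separated_Wall v : valid v -> v <> Wall -> separated v Wall /\ separated Wall v.
Proof.
move=> vv vX; have [f1 f2 f3] := free_box vv.
suff le : left_of v + (size_of v)%:i <= left_of Wall.
  by split; left; [constructor 1; exact: le_trans f2 le|constructor 2; exact: le].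
case lv : (line_of v) => [[[h i] k]|].
  have [[_ iR kK] [_ vr _ _]] := line_box vv lv.
  by have := mulz_mono (2 * unit_len) (iR : (i.+1 < R.+1)%N); rewrite /=; lia.
case: v vv vX lv {f1 f2 f3} => //= h i /andP[_ iR] _ _.
by have := mulz_mono (2 * unit_len) iR; lia.
Qed.

(** The delicate case is the hub just right of the crossed tip: the [Diag] pieces of its row stay
    below a hypotenuse line passing left of its corner. *)
Lemma separated_Hub_line h i v h' i' k : valid (Hub h i) -> valid v ->
  line_of v = Some (h', i', k) -> separated (Hub h i) v.
Proof.
move=> /andP[hM iR] vv lv; have [[h'M i'R kK] [b1 b2 b3 b4]] := line_box vv lv.
have [s1 s2 s3 [s4 s5]] := line_facts kK; have re0 := offset_le0 kK.
rewrite /separated /free_right /free_left /free_top /hyp_of /=.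
have [lt|lt|eqi] := ltngtP i i'.+1.
- left; constructor 1; have := mulz_le (2 * unit_len) (lt : (i <= i')%N); lia.
- by left; constructor 2; have := mulz_mono (2 * unit_len) lt; lia.
subst i; case: v vv lv b1 b2 b3 b4 => //= h'' i'' k' j /and4P[_ _ _ jn] [? ? ?];
  move=> b1 b2 b3 b4; subst.
- left; constructor 2.
  by have := count_mul (thin k) jn; rewrite num_vertE // => ?; lia.
- left; have [lt|lt|eqh] := ltngtP h h'.
  + by constructor 3; have := mulz_mono (3 * unit_len) lt; lia.
  + by constructor 4; have := mulz_mono (3 * unit_len) lt; lia.
  + by constructor 4; subst; lia.
- have := count_mul (thick k) jn; rewrite num_diagE // => jD.
  have [lt|lt|eqh] := ltngtP h h'.
  + by left; constructor 3; have := mulz_mono (3 * unit_len) lt; lia.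
  + by left; constructor 4; have := mulz_mono (3 * unit_len) lt; lia.
  + by right; left; subst; lia.
Qed.

Lemma separated_line_Hub h i v h' i' k : valid (Hub h i) -> valid v ->
  line_of v = Some (h', i', k) -> separated v (Hub h i).
Proof.
move=> /andP[hM iR] vv lv; have [[h'M i'R kK] [b1 b2 b3 b4]] := line_box vv lv.
have [f1 f2 f3] := free_box vv.
have [s1 s2 s3 [s4 s5]] := line_facts kK; have re0 := offset_le0 kK.
have [s01 s02 s03 [s04 s05]] := line_facts (leq_ltn_trans (leq0n k) kK).
have [lt|lt|eqi] := ltngtP i i'.
- by left; constructor 2; have := mulz_mono (2 * unit_len) lt; rewrite /=; lia.
- have [lt'|lt'|eqi'] := ltngtP i'.+1 i.
  + by left; constructor 1; have := mulz_mono (2 * unit_len) lt'; rewrite /=; lia.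
  + by move: lt lt'; lia.
  subst i; case: v vv lv b1 b2 b3 b4 f1 f2 f3 => //= h'' i'' k' j /and4P[_ _ _ jn] [? ? ?];
    move=> b1 b2 b3 b4 f1 f2 f3; subst.
  + by left; constructor 1; rewrite /=; lia.
  + left; have [lt'|lt'|eqh] := ltngtP h h'.
    * by constructor 4; have := mulz_mono (3 * unit_len) lt'; rewrite /=; lia.
    * by constructor 3; have := mulz_mono (3 * unit_len) lt'; rewrite /=; lia.
    * by constructor 3; subst; rewrite /=; lia.
  + have := count_mul (thick k) jn; rewrite num_diagE // => jD.
    have [lt'|lt'|eqh] := ltngtP h h'.
    * by left; constructor 4; have := mulz_mono (3 * unit_len) lt'; rewrite /=; lia.
    * by left; constructor 3; have := mulz_mono (3 * unit_len) lt'; rewrite /=; lia.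
    * by right; right; subst; rewrite /hyp_of /=; lia.
subst i; case: v vv lv b1 b2 b3 b4 f1 f2 f3 => //= h'' i'' k' j /and4P[_ _ _ jn] [? ? ?];
  move=> b1 b2 b3 b4 f1 f2 f3; subst.
- have jV := count_mul (thin k) jn; rewrite num_vertE // in jV.
  have [lt|lt|eqh] := ltngtP h'.+1 h.+2; last first.
  (* The first [Vert] starts [gap k] inside the hub, so its free part begins exactly on the line of
     the hub's hypotenuse. *)
  + right; left; have {eqh} : (h' = h.+1)%N by lia.
    move=> ?; subst; rewrite /hyp_of /=.
    by case: j jn {b1 b2 b3 b4 f1 f2 f3} jV => [|j] _ jV /=; lia.
  + left; constructor 4; rewrite /=.
    by have := mulz_mono (3 * unit_len) (lt : (h.+1 < h')%N); lia.
  + left; constructor 3; have := mulz_le (3 * unit_len) (lt : (h' <= h)%N); rewrite /=; lia.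
- left; have [lt|lt|eqh] := ltngtP h h'.
  + by constructor 4; have := mulz_mono (3 * unit_len) lt; rewrite /=; lia.
  + by constructor 3; have := mulz_mono (3 * unit_len) lt; rewrite /=; lia.
  + by constructor 3; subst; rewrite /=; lia.
- left; have := count_mul (thick k) jn; rewrite num_diagE // => jD.
  have [lt|lt|eqh] := ltngtP h h'.
  + by constructor 4; have := mulz_mono (3 * unit_len) lt; rewrite /=; lia.
  + by constructor 3; have := mulz_mono (3 * unit_len) lt; rewrite /=; lia.
  + constructor 3; subst.
    by case: j jn jD {b1 b2 b3 b4 f1 f2 f3} => [|j] _ jD; rewrite /free_top /=; lia.
Qed.

Lemma separated_same_line v u h i k : valid v -> valid u -> v <> u ->
  line_of v = Some (h, i, k) -> line_of u = Some (h, i, k) -> separated v u.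
Proof.
move=> vv uu vu lv lu; left; have [[hM iR kK] [b1 b2 b3 b4]] := line_box vv lv.
have [s1 s2 s3 [s4 s5]] := line_facts kK; have [f1 f2 f3] := free_box vv.
case: v vv vu lv f1 f2 f3 {b1 b2 b3 b4} => //= h1 i1 k1 j /and4P[_ _ _ jn] vu [? ? ?];
move=> f1 f2 f3; subst h1 i1 k1;
case: u uu vu lu => //= h2 i2 k2 j' /and4P[_ _ _ jn'] vu [? ? ?]; subst h2 i2 k2.
- have [lt|lt|eqj] := ltngtP j j'; last by subst.
  + by constructor 3; have := mulz_mono (thin k) lt; rewrite /=; lia.
  + by constructor 4; have := mulz_mono (thin k) lt; rewrite /=; lia.
- by constructor 3; have := count_mul (thin k) jn; rewrite num_vertE //=; lia.
- constructor 3; have := count_mul (thin k) jn; rewrite num_vertE //=.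
  by have := count_mul (thick k) jn'; rewrite num_diagE //=; lia.
- by constructor 4; have := count_mul (thin k) jn'; rewrite num_vertE //=; lia.
- have [lt|lt|eqj] := ltngtP j j'; last by subst.
  + by constructor 1; have := mulz_mono (thin k) lt; rewrite /=; lia.
  + by constructor 2; have := mulz_mono (thin k) lt; rewrite /=; lia.
- have := count_mul (thin k) jn; have := num_horizE kK => eqH leH.
  (* The last [Diag] stands to the right of the horizontal part, all others above it. *)
  move: (jn'); rewrite leq_eqVlt => /orP[/eqP jE|lt].
    by constructor 1; have := num_diagE kK; rewrite -jE /=; lia.
  by constructor 3; have := count_mul (thick k) lt; rewrite num_diagE //=; lia.
- constructor 4; have := count_mul (thin k) jn'; rewrite num_vertE //=.
  by have := count_mul (thick k) jn; rewrite num_diagE //=; lia.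
- have := count_mul (thin k) jn'; have := num_horizE kK => eqH leH.
  move: (jn); rewrite leq_eqVlt => /orP[/eqP jE|lt].
    by constructor 2; have := num_diagE kK; rewrite -jE /=; lia.
  by constructor 4; have := count_mul (thick k) lt; rewrite num_diagE //=; lia.
- have [lt|lt|eqj] := ltngtP j j'; last by subst.
  + by constructor 1; have := mulz_mono (thick k) lt; rewrite /=; lia.
  + by constructor 2; have := mulz_mono (thick k) lt; rewrite /=; lia.
Qed.

(** Followed upwards, the finer line [l] stays on the right-hand side of line [k]: right of its
    vertical part, below its horizontal part, and beyond the hypotenuses of its diagonal part. *)
Lemma separated_same_bundle v u h i k l : valid v -> valid u -> (k < l)%N ->
  line_of v = Some (h, i, k) -> line_of u = Some (h, i, l) ->
  separated v u /\ separated u v.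
Proof.
move=> vv uu kl lv lu; have [[_ _ kK] _] := line_box vv lv.
have [[_ _ lK] _] := line_box uu lu.
have [s1 s2 s3 [s4 s5]] := line_facts kK; have [t1 t2 t3 [t4 t5]] := line_facts lK.
have nest := line_nested kl lK.
have [f1 f2 f3] := free_box vv; have [e1 e2 e3] := free_box uu.
rewrite /separated.
case: v vv lv f1 f2 f3 => //= h1 i1 k1 j /and4P[_ _ _ jn] [? ? ?] f1 f2 f3; subst h1 i1 k1;
case: u uu lu e1 e2 e3 => //= h2 i2 k2 j' /and4P[_ _ _ jn'] [? ? ?] e1 e2 e3; subst h2 i2 k2.
- by split; left; [constructor 1|constructor 2]; rewrite /=; lia.
- by split; left; [constructor 1|constructor 2]; rewrite /=; lia.
- by split; left; [constructor 1|constructor 2]; rewrite /=; lia.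
- have := count_mul (thin l) jn'; rewrite num_vertE // => ?.
  by split; left; [constructor 4|constructor 3]; rewrite /=; lia.
- by split; left; [constructor 4|constructor 3]; rewrite /=; lia.
- have := count_mul (thin k) jn; have := num_horizE kK => ? ?.
  by rewrite /hyp_of /=; split; right; [right|left]; lia.
- have := count_mul (thin l) jn'; rewrite num_vertE // => ?.
  have := count_mul (thick k) jn; rewrite num_diagE // => ?.
  by split; left; [constructor 4|constructor 3]; rewrite /=; lia.
- have := count_mul (thick k) jn; rewrite num_diagE // => ?.
  by split; left; [constructor 4|constructor 3]; rewrite /=; lia.
- by rewrite /hyp_of /=; split; right; [right|left]; lia.
Qed.

(** Heights can overlap only if [k < l], for a [Diag] of line [k] and a [Vert] of line [l]; that
    [Vert] then lies beyond the hypotenuse of the [Diag], since [gap l < gap k]. *)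
Lemma separated_next_bundle v u h i k l : valid v -> valid u ->
  line_of v = Some (h, i, k) -> line_of u = Some (h.+1, i, l) ->
  separated v u /\ separated u v.
Proof.
move=> vv uu lv lu; have [[_ _ kK] [_ _ _ b4]] := line_box vv lv.
have [[_ _ lK] [_ _ c3 _]] := line_box uu lu.
have [s1 s2 s3 [s4 s5]] := line_facts kK; have [t1 t2 t3 [t4 t5]] := line_facts lK.
have [f1 f2 f3] := free_box vv; have [e1 e2 e3] := free_box uu.
have below : bottom_of v + (size_of v)%:i <= bottom_of u -> separated v u /\ separated u v.
  by move=> vu; split; left; [constructor 3|constructor 4]; lia.
case: v vv lv b4 f1 f2 f3 below => //= h1 i1 k1 j /and4P[_ _ _ jn] [? ? ?];
  move=> b4 f1 f2 f3 below; subst h1 i1 k1.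
- by apply: below; have := count_mul (thin k) jn; rewrite num_vertE //; lia.
- by apply: below; lia.
case: u uu lu c3 e1 e2 e3 below => //= h2 i2 k2 j' /and4P[_ _ _ jn'] [? ? ?];
  move=> c3 e1 e2 e3 below; subst h2 i2 k2.
- have [kl|lk|eqk] := ltngtP k l.
  + have nest := line_nested kl lK.
    by rewrite /separated /hyp_of /=; split; right; [right|left]; lia.
  + by have nest := line_nested lk kK; apply: below; lia.
  + by apply: below; subst; lia.
- by apply: below; lia.
- by have := count_mul (thick l) jn'; rewrite num_diagE // => ?; apply: below; lia.
Qed.

Lemma separatedP v u : valid v -> valid u -> v <> u -> separated v u.
Proof.
move=> vv uu vu; have [uX|uX] := pselect (u = Wall).
  by subst; have [] := separated_Wall vv vu.
have [vX|vX] := pselect (v = Wall).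
  by subst; have [] := separated_Wall uu uX.
case lu : (line_of u) => [[[h' i'] l]|]; case lv : (line_of v) => [[[h i] k]|].
- have [[_ iR kK] [b1 b2 b3 b4]] := line_box vv lv.
  have [[_ iR' lK] [c1 c2 c3 c4]] := line_box uu lu.
  have [s1 s2 s3 [s4 s5]] := line_facts kK; have [t1 t2 t3 [t4 t5]] := line_facts lK.
  have [f1 f2 f3] := free_box vv.
  have [lt|lt|eqi] := ltngtP i i'.
  + left; constructor 1; have := mulz_mono (2 * unit_len) (lt : (i.+1 < i'.+1)%N); lia.
  + left; constructor 2; have := mulz_mono (2 * unit_len) (lt : (i'.+1 < i.+1)%N); lia.
  subst i'; have [lt|lt|eqh] := ltngtP h h'.
  + move: (lt); rewrite leq_eqVlt => /orP[/eqP hE|lt'].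
      by rewrite -hE in lu; have [] := separated_next_bundle vv uu lv lu.
    left; constructor 3; have := mulz_mono (3 * unit_len) lt'; rewrite mulSn; lia.
  + move: (lt); rewrite leq_eqVlt => /orP[/eqP hE|lt'].
      by rewrite -hE in lv; have [] := separated_next_bundle uu vv lu lv.
    left; constructor 4; have := mulz_mono (3 * unit_len) lt'; rewrite mulSn; lia.
  subst h'; have [lt|lt|eqk] := ltngtP k l.
  + by have [] := separated_same_bundle vv uu lt lv lu.
  + by have [] := separated_same_bundle uu vv lt lu lv.
  + by subst l; apply: separated_same_line lv lu.
- by case: v vv vX lv {vu} => // h i vv _ _; apply: separated_Hub_line lu.
- by case: u uu uX lu {vu} => // h' i' uu _ _; apply: separated_line_Hub lv.
- case: v vv vu vX lv => // h i _ vu _ _; case: u uu vu uX lu => // h' i' _ vu _ _.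
  exact: separated_Hub_Hub.
Qed.

Lemma size_gt0 v : valid v -> (0 < size_of v)%N.
Proof.
have d0 : (0 < unit_len)%N by rewrite expn_gt0 W_gt0.
case: v => [|h i|h i k j|h i k j|h i k j] //=; first by lia.
all: case/and4P=> _ _ kK _; have [] := line_facts kK; lia.
Qed.

(** This is where the ratios [N] between [gap] and [thin], and between [offset] and [thick], are
    spent. *)
Lemma free_cut v : (0 < K)%N -> valid v ->
  [/\ left_of v <= free_left v /\ free_left v <= left_of v + (size_of v)%:i,
      left_of v <= free_right v /\ free_right v <= left_of v + (size_of v)%:i,
      bottom_of v <= free_top v /\ free_top v <= bottom_of v + (size_of v)%:i &
      ((free_left v - left_of v) + (left_of v + (size_of v)%:i - free_right v) +
       (bottom_of v + (size_of v)%:i - free_top v)) * N%:i <= (size_of v)%:i].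
Proof.
move=> K0; rewrite /free_left /free_right /free_top.
have [s01 s02 s03 [s04 s05]] := line_facts K0.
case: v => [|h i|h i k [|j]|h i k j|h i k [|j]] vv; try by split; rewrite /=; lia.
- split; rewrite /=; try lia.
  by have : (thick 0 = N * offset 0)%N by []; nia.
- case/and4P: vv => _ _ kK _; have [s1 s2 s3 [s4 s5]] := line_facts kK.
  split; rewrite /=; try lia.
  by have : (thin k = N * gap k)%N by []; nia.
- case/and4P: vv => _ _ kK _; have [s1 s2 s3 [s4 s5]] := line_facts kK.
  split; rewrite /=; try lia.
  by have : (thick k = N * offset k)%N by []; nia.
Qed.

(* The bottom side of [v] meets the left side of [u]. *)
Definition touches (v u : piece) : Prop :=
  [/\ left_of v <= left_of u, left_of u <= left_of v + (size_of v)%:i,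
      bottom_of u <= bottom_of v & bottom_of v <= bottom_of u + (size_of u)%:i].

(** * Contacts between pieces *)

Lemma touches_Hub_Hub h i : touches (Hub h i) (Hub h i.+1).
Proof. by split; rewrite /=; lia. Qed.

Lemma touches_Hub_Wall h : (h < M)%N -> touches (Hub h R) Wall.
Proof. by move=> hM; have := mulz_mono (3 * unit_len) hM; split; rewrite /=; lia. Qed.

Lemma touches_Hub_Diag h i k : (k < K)%N -> touches (Hub h i) (Diag h i k 0).
Proof. by move=> kK; have [? ? ? [? ?]] := line_facts kK; split; rewrite /=; lia. Qed.

Lemma touches_Diag_Diag h i k j : touches (Diag h i k j) (Diag h i k j.+1).
Proof. by split; rewrite /=; lia. Qed.

Lemma touches_Horiz_Horiz h i k j : touches (Horiz h i k j) (Horiz h i k j.+1).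
Proof. by split; rewrite /=; lia. Qed.

Lemma touches_Vert_Vert h i k j : touches (Vert h i k j.+1) (Vert h i k j).
Proof. by split; rewrite /=; lia. Qed.

Lemma num_vert_gt0 k : (0 < num_vert k)%N.
Proof. by rewrite !muln_gt0 expn_gt0 W_gt0; lia. Qed.

Lemma num_diag_gt0 k : (0 < num_diag k)%N.
Proof. by rewrite !muln_gt0 expn_gt0 W_gt0. Qed.

Lemma num_horiz_gt0 k : (0 < num_horiz k)%N.
Proof.
have : (0 < W ^ k)%N by rewrite expn_gt0 W_gt0.
by rewrite /num_horiz; set w := (W ^ k)%N => w0; nia.
Qed.

Lemma touches_Horiz_Diag h i k : (k < K)%N ->
  touches (Horiz h i k (num_horiz k).-1) (Diag h i k (num_diag k).-1).
Proof.
move=> kK; have := num_horizE kK; have := num_diagE kK; have [? ? ? [? ?]] := line_facts kK.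
rewrite -(prednK (num_horiz_gt0 k)) -(prednK (num_diag_gt0 k)).
move: (num_horiz k).-1 (num_diag k).-1 => a b.
by split; rewrite /=; lia.
Qed.

Lemma touches_Horiz_Vert h i k : (k < K)%N ->
  touches (Horiz h i k 0) (Vert h i k (num_vert k).-1).
Proof.
move=> kK; have := num_vertE kK; rewrite -(prednK (num_vert_gt0 k)); move: (num_vert k).-1 => a.
by split; rewrite /=; lia.
Qed.

(** Continues a line beyond row [h], so that a column crosses all rows. *)
Lemma touches_Vert_Diag h i k : (k < K)%N -> touches (Vert h.+1 i k 0) (Diag h i k 0).
Proof. by move=> kK; have [? ? ? [? ?]] := line_facts kK; split; rewrite /=; lia. Qed.

End Arrangement.

(** * Its intersection graph *)

Section Pieces.
Variables (N K M R : nat).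

Definition line_length : nat := (8 * N * (4 * N ^ 2) ^ K)%N.

(** Bounded coordinates yield finitely many candidates, from which [valid] selects; [line_length]
    bounds the number of pieces of each part. *)
Definition decode_index
    (c : 'I_5 * ('I_M * 'I_R.+1 * 'I_K * 'I_line_length)) : piece :=
  let: (p, (h, i, k, j)) := c in
  piece_decode (val p, (val h, val i, val k, val j)).

Definition pieces : seq piece :=
  [seq v <- Wall :: [seq Hub h i | h <- iota 0 M, i <- iota 0 R.+1] ++ codom decode_index
    | valid N K M R v].

Lemma counts_le k : (2 <= N)%N -> (k < K)%N ->
  [/\ (num_vert N k <= line_length)%N, (num_horiz N k <= line_length)%N &
      (num_diag N k <= line_length)%N].
Proof.
move=> N2 kK; have : ((4 * N ^ 2) ^ k <= (4 * N ^ 2) ^ K)%N.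
  by rewrite leq_exp2l //; [exact: ltnW|nia].
rewrite /num_vert /num_horiz /num_diag /line_length.
set a := (_ ^ k)%N; set b := (_ ^ K)%N => ab.
by split; nia.
Qed.

Lemma mem_pieces v : (2 <= N)%N -> (v \in pieces) = valid N K M R v.
Proof.
move=> N2; rewrite mem_filter andb_idr // inE mem_cat => vv.
have mk p h i k j : (p < 5)%N -> (h < M)%N -> (i < R)%N -> (k < K)%N ->
    (j < line_length)%N -> piece_decode (p, (h, i, k, j)) \in codom decode_index.
  move=> p5 hM iR kK jL.
  have iR' : (i < R.+1)%N := ltnW iR.
  exact: (codom_f decode_index
    (Ordinal p5, (Ordinal hM, Ordinal iR', Ordinal kK, Ordinal jL))).
case: v vv => [_|h i /andP[hM iR]|h i k j|h i k j|h i k j].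
- by rewrite eqxx.
- apply/orP; right; apply/orP; left; apply/allpairsP; exists (h, i).
  by rewrite !mem_iota.
all: case/and4P=> hM iR kK jn; have [c1 c2 c3] := counts_le N2 kK; do 2!(apply/orP; right).
- exact: (mk 2%N h i k j isT hM iR kK (leq_trans jn c1)).
- exact: (mk 3%N h i k j isT hM iR kK (leq_trans jn c2)).
- exact: (mk 4%N h i k j isT hM iR kK (leq_trans jn c3)).
Qed.

End Pieces.

(** * The collection of copies, its graph, and distances to the wall *)

Section Collection.
Variables (Rt : realType) (S : set (Rt * Rt)).
Hypothesis mS : measurable S.
Hypothesis S_triangle : forall z, S z -> [/\ 0 <= z.1, 0 <= z.2 & z.1 + z.2 <= 1].
Hypothesis S_square : forall z : Rt * Rt,
  0 <= z.1 -> z.1 <= 4^-1 -> 0 <= z.2 -> z.2 <= 4^-1 -> S z.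
Hypothesis S_hleg : forall t, 0 <= t -> t <= 1 -> S (t, 0).
Hypothesis S_vleg : forall t, 0 <= t -> t <= 1 -> S (0, t).
Variables (N K M R : nat).
Hypotheses (N_ge2 : (2 <= N)%N) (K_gt0 : (0 < K)%N).

Local Notation valid := (valid N K M R).
Local Notation left_of := (left_of N K R).
Local Notation bottom_of := (bottom_of N K).
Local Notation size_of := (size_of N K M).
Local Notation touches := (touches N K M R).
Local Notation "n '%:i'" := (Posz n) (at level 2, format "n '%:i'").

Definition placed (v : piece) : set (Rt * Rt) :=
  homothet S (size_of v)%:R ((left_of v)%:~R, (bottom_of v)%:~R).

Lemma placed_size_gt0 v : valid v -> 0 < (size_of v)%:R :> Rt.
Proof. by move=> vv; rewrite ltr0n; apply: size_gt0 vv. Qed.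

Lemma placed_hleg v (x : Rt) : valid v ->
  (left_of v)%:~R <= x -> x <= (left_of v + (size_of v)%:i)%:~R ->
  placed v (x, (bottom_of v)%:~R).
Proof.
move=> vv; rewrite rmorphD /= -pmulrn => x1 x2; have s0 := placed_size_gt0 vv.
rewrite /placed homothetE //= subrr mulr0; apply: S_hleg.
  by apply: mulr_ge0; [rewrite invr_ge0 ltW|lra].
by rewrite mulrC ler_pdivrMr //; lra.
Qed.

Lemma placed_vleg v (y : Rt) : valid v ->
  (bottom_of v)%:~R <= y -> y <= (bottom_of v + (size_of v)%:i)%:~R ->
  placed v ((left_of v)%:~R, y).
Proof.
move=> vv; rewrite rmorphD /= -pmulrn => x1 x2; have s0 := placed_size_gt0 vv.
rewrite /placed homothetE //= subrr mulr0; apply: S_vleg.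
  by apply: mulr_ge0; [rewrite invr_ge0 ltW|lra].
by rewrite mulrC ler_pdivrMr //; lra.
Qed.

Lemma touches_meet v u : valid v -> valid u -> touches v u ->
  placed v `&` placed u !=set0.
Proof.
move=> vv uu [c1 c2 c3 c4]; exists ((left_of u)%:~R, (bottom_of v)%:~R).
by split; [apply: placed_hleg|apply: placed_vleg]; rewrite // ler_int.
Qed.

Lemma placed_free v u (z : Rt * Rt) : valid v -> valid u -> v <> u -> placed v z ->
  (free_left N K R v)%:~R < z.1 < (free_right N K M R v)%:~R ->
  (bottom_of v)%:~R < z.2 < (free_top N K M v)%:~R -> ~ placed u z.
Proof.
move=> vv uu vu /(homothet_triangle S_triangle (placed_size_gt0 vv)) /= [_ _ v3].
case/andP=> x1 x2 /andP[y1 y2].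
case/(homothet_triangle S_triangle (placed_size_gt0 uu)) => /= u1 u2 u3.
have cast (a b : int) : a <= b -> a%:~R <= b%:~R :> Rt by rewrite ler_int.
case: (separatedP N_ge2 vv uu vu) => [[] /cast|[/cast|]];
  rewrite ?rmorphD /= -?pmulrn /hyp_of ?rmorphD /= -?pmulrn; try lra.
by rewrite -(ltr_int Rt) ?rmorphD /= -?pmulrn; lra.
Qed.

Definition vertices : finType := seq_sub (pieces N K M R).

Lemma vertex_valid (v : vertices) : valid (val v).
Proof. by rewrite -mem_pieces // ssvalP. Qed.

Definition meets (u v : vertices) : bool :=
  (u != v) && `[< placed (val u) `&` placed (val v) !=set0 >].

Lemma meets_sym : symmetric meets.
Proof. by move=> u v; rewrite /meets eq_sym setIC. Qed.

Lemma meets_irrefl : irreflexive meets.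
Proof. by move=> u; rewrite /meets eqxx. Qed.

Definition piece_graph : sgraph := SGraph meets_sym meets_irrefl.

Lemma piece_graph_class (alpha : Rt) : alpha <= 1 -> 16 / N%:R <= 1 - alpha ->
  intersection_class S alpha piece_graph.
Proof.
move=> a1 aN; exists (fun v => placed (val v)); split.
- move=> v; exists (size_of (val v))%:R, ((left_of (val v))%:~R, (bottom_of (val v))%:~R).
  by split=> //; apply/placed_size_gt0/vertex_valid.
- move=> v; have vv := vertex_valid v; have s0 := placed_size_gt0 vv.
  have [[l1 l2] [r1 r2] [t1 t2] cut] := free_cut N_ge2 K_gt0 vv.
  have cast (a b : int) : a <= b -> a%:~R <= b%:~R :> Rt by rewrite ler_int.
  have N0 : 0 < N%:R :> Rt by rewrite ltr0n; lia.
  apply: (@homothet_free _ S mS S_triangle S_square _ alpha N%:R^-1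
    (free_left N K R (val v))%:~R (free_right N K M R (val v))%:~R
    (bottom_of (val v))%:~R (free_top N K M (val v))%:~R) => //=;
  try (rewrite pmulrn -rmorphD /=); try exact: cast.
  + apply: fin_bigcup_measurable => [|u _]; first exact: finite_finset.
    by apply: measurable_homothet => //; apply/placed_size_gt0/vertex_valid.
  + by rewrite ler_int lerDl.
  + rewrite mulrC ler_pdivlMr //; move/cast: cut.
    by rewrite rmorphM /= !rmorphD /= !rmorphN /= -!pmulrn; lra.
  + move=> z vz x y [u /= uv uz]; apply: placed_free vv (vertex_valid u) _ vz x y uz.
    by move=> /val_inj vu; rewrite vu eqxx in uv.
- move=> u v; rewrite /= /meets; split=> [/andP[uv /asboolP//]|[uv uv']].
  by rewrite uv; apply/asboolP.
Qed.

Definition vertex (v : piece) (vv : valid v) : piece_graph :=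
  SeqSub (etrans (mem_pieces K M R v N_ge2) vv).

Lemma vertexK (v : piece_graph) : v = vertex (vertex_valid v).
Proof. exact: val_inj. Qed.

Definition linked (v u : piece) : Prop := touches v u \/ touches u v.

Lemma adj_linked v u (vv : valid v) (uu : valid u) : v <> u -> linked v u ->
  adj (vertex vv) (vertex uu).
Proof.
move=> vu lk; apply/andP; split; first by apply/eqP => /(congr1 val).
apply/asboolP; case: lk => [/touches_meet|/touches_meet]; first by apply.
by rewrite setIC; apply.
Qed.

(** Quantifying over the proof of validity makes this a property of pieces, which suits induction on
    their indices. *)
Definition near_wall (n : nat) (v : piece) : Prop :=
  forall vv : valid v, within (vertex (isT : valid Wall)) n (vertex vv).

Lemma near_wall_linked n v u : valid v -> linked v u -> near_wall n v -> near_wall n.+1 u.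
Proof.
move=> vv lk nv uu; have [vu|vu] := pselect (v = u).
  by subst u; apply: (within_le (leqnSn n)); apply: nv.
exact: withinS (nv vv) (adj_linked vv uu vu lk).
Qed.

Lemma near_wall_le m n v : (m <= n)%N -> near_wall m v -> near_wall n v.
Proof. by move=> mn nv vv; apply: within_le (nv vv). Qed.

Lemma near_wall_Wall : near_wall 0 Wall.
Proof. by move=> vv; rewrite (bool_irrelevance vv isT); apply: within0. Qed.

Lemma near_wall_Hub h i : (h < M)%N -> (i <= R)%N -> near_wall (R - i).+1 (Hub h i).
Proof.
move=> hM iR; move: {-1}(R - i)%N (erefl (R - i)%N) => d.
elim: d i iR => [|d IHd] i iR dE.
  have -> : i = R by lia.
  by apply: near_wall_linked near_wall_Wall => //; right; apply: touches_Hub_Wall.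
have iR' : (i.+1 <= R)%N by lia.
apply: (near_wall_linked (v := Hub h i.+1)); first by rewrite /= hM.
  by right; apply: touches_Hub_Hub.
by apply: IHd => //; lia.
Qed.

Lemma near_wall_Diag h i k j : valid (Diag h i k j) -> near_wall (R.+2 + j) (Diag h i k j).
Proof.
move=> /and4P[hM iR kK]; elim: j => [|j IHj] jn.
  apply: (near_wall_le (m := (R - i).+2)); first by lia.
  apply: (near_wall_linked (v := Hub h i)); first by rewrite /= hM ltnS ltnW.
    by left; apply: touches_Hub_Diag.
  by apply: near_wall_Hub; rewrite // ltnW.
rewrite addnS; apply: (near_wall_linked (v := Diag h i k j)).
- by rewrite /= hM iR kK ltnW.
- by left; apply: touches_Diag_Diag.
- by apply: IHj; rewrite ltnW.
Qed.

(** The walk comes from the last [Diag], so indices count back from the last [Horiz]; beyond the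
    first one, truncated subtraction makes the index stay at 0. *)
Lemma near_wall_Horiz h i k d : valid (Horiz h i k ((num_horiz N k).-1 - d)) ->
  near_wall (R.+2 + num_diag N k + d) (Horiz h i k ((num_horiz N k).-1 - d)).
Proof.
move=> /and4P[hM iR kK _]; have H0 := num_horiz_gt0 N_ge2 k; have D0 := num_diag_gt0 N_ge2 k.
elim: d => [|d IHd].
  rewrite subn0 addn0 -(prednK D0) addnS.
  apply: (near_wall_linked (v := Diag h i k (num_diag N k).-1)).
  - by rewrite /= hM iR kK /=; lia.
  - by right; apply: touches_Horiz_Diag.
  - by apply: near_wall_Diag; rewrite /= hM iR kK /=; lia.
rewrite addnS; have [dn|dn] := ltnP d (num_horiz N k).-1; last first.
  rewrite (_ : (num_horiz N k).-1 - d.+1 = (num_horiz N k).-1 - d)%N; last by lia.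
  exact: near_wall_le IHd.
rewrite -(subnSK dn) in IHd *.
apply: near_wall_linked IHd; first by rewrite /= hM iR kK; lia.
by right; apply: touches_Horiz_Horiz.
Qed.

Lemma near_wall_Vert h i k d : valid (Vert h i k ((num_vert N k).-1 - d)) ->
  near_wall (R.+2 + num_diag N k + num_horiz N k + d) (Vert h i k ((num_vert N k).-1 - d)).
Proof.
move=> /and4P[hM iR kK _]; have H0 := num_horiz_gt0 N_ge2 k; have V0 := num_vert_gt0 N_ge2 k.
elim: d => [|d IHd].
  have vH : valid (Horiz h i k ((num_horiz N k).-1 - (num_horiz N k).-1)).
    by rewrite subnn /= hM iR kK H0.
  rewrite subn0 addn0 -{1}(prednK H0) addnS.
  apply: near_wall_linked (near_wall_Horiz vH) => //; rewrite subnn.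
  by left; apply: touches_Horiz_Vert.
rewrite addnS; have [dn|dn] := ltnP d (num_vert N k).-1; last first.
  rewrite (_ : (num_vert N k).-1 - d.+1 = (num_vert N k).-1 - d)%N; last by lia.
  exact: near_wall_le IHd.
rewrite -(subnSK dn) in IHd *.
apply: near_wall_linked IHd; first by rewrite /= hM iR kK; lia.
by left; apply: touches_Vert_Vert.
Qed.

Lemma near_wall_all v : valid v -> near_wall (R.+2 + 3 * line_length N K) v.
Proof.
case: v => [_|h i /andP[hM iR]|h i k j vv|h i k j vv|h i k j vv].
- exact: near_wall_le near_wall_Wall.
- by apply: near_wall_le (near_wall_Hub hM _); lia.
- have /and4P[_ _ kK jn] := vv; have [c1 c2 c3] := counts_le N_ge2 kK.
  have jE : j = ((num_vert N k).-1 - ((num_vert N k).-1 - j))%N by lia.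
  by rewrite jE in vv *; apply: near_wall_le (near_wall_Vert vv); lia.
- have /and4P[_ _ kK jn] := vv; have [c1 c2 c3] := counts_le N_ge2 kK.
  have jE : j = ((num_horiz N k).-1 - ((num_horiz N k).-1 - j))%N by lia.
  by rewrite jE in vv *; apply: near_wall_le (near_wall_Horiz vv); lia.
- have /and4P[_ _ kK jn] := vv; have [c1 c2 c3] := counts_le N_ge2 kK.
  by apply: near_wall_le (near_wall_Diag vv); lia.
Qed.

(** * Rows and columns as connected sets *)

Definition piece_set (P : pred piece) : {set piece_graph} :=
  [set v : piece_graph | P (val v)]%SET.

Section Connect.
Variables (P : pred piece) (r : piece) (rr : valid r).

Definition reached (v : piece) : Prop := forall vv : valid v,
  connect [rel a b | [&& a \in piece_set P, b \in piece_set P & adj a b]]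
    (vertex rr) (vertex vv).

Lemma reached_root : reached r.
Proof. by move=> vv; rewrite (bool_irrelevance rr vv). Qed.

Lemma reached_linked v u : valid v -> P v -> P u -> linked v u -> reached v -> reached u.
Proof.
move=> vv Pv Pu lk rv uu; have [vu|vu] := pselect (v = u).
  by subst u; apply: rv.
by apply: connect_trans (rv vv) (connect1 _); rewrite /= !inE Pv Pu; apply: adj_linked.
Qed.

Lemma piece_set_connected : (forall v, valid v -> P v -> reached v) ->
  induces_connected (piece_set P).
Proof.
move=> all_reached.
pose e : rel piece_graph := [rel a b | [&& a \in piece_set P, b \in piece_set P & adj a b]].
have e_sym : symmetric e.
  by move=> a b; rewrite /e /= meets_sym andbCA.
have from_root u : u \in piece_set P -> connect e (vertex rr) u.
  by rewrite inE => Pu; rewrite (vertexK u); apply: all_reached => //; apply: vertex_valid.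
move=> u v uP vP; apply: connect_trans (from_root v vP).
by rewrite (sym_connect_sym e_sym); apply: from_root.
Qed.

End Connect.

Definition in_row (h : nat) : pred piece := fun v => if v is Hub h' _ then h' == h else false.

Definition in_col (i k : nat) : pred piece :=
  fun v => if line_of v is Some (_, i', k') then (i' == i) && (k' == k) else false.

Lemma row_connected h : (h < M)%N -> induces_connected (piece_set (in_row h)).
Proof.
move=> hM; have rr : valid (Hub h 0) by rewrite /= hM.
apply: (piece_set_connected (rr := rr)).
move=> -[|h' i|h' i k j|h' i k j|h' i k j] //= /andP[_ iR] /eqP ->.
elim: i iR => [|i IHi] iR; first exact: reached_root.
apply: (reached_linked (v := Hub h i)); rewrite /in_row ?eqxx //.
- by rewrite /= hM ltnW.
- by left; apply: touches_Hub_Hub.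
- by apply: IHi; rewrite ltnW.
Qed.

(** Starting from the lowest [Vert], follow the line up, to the right, and back along the [Diag]
    pieces from the last to the first, which touches the first [Vert] of the next row. *)
Lemma col_connected i k : (0 < M)%N -> (i < R)%N -> (k < K)%N ->
  induces_connected (piece_set (in_col i k)).
Proof.
move=> M0 iR kK; have V0 := num_vert_gt0 N_ge2 k.
have H0 := num_horiz_gt0 N_ge2 k; have D0 := num_diag_gt0 N_ge2 k.
have rr : valid (Vert 0 i k 0) by rewrite /= M0 iR kK V0.
have inP h : (forall j, in_col i k (Vert h i k j)) /\ (forall j, in_col i k (Horiz h i k j)) /\
    (forall j, in_col i k (Diag h i k j)) by rewrite /in_col /= !eqxx.
pose on_col := @reached (in_col i k) _ rr.
have on_col_vert h : (h < M)%N -> on_col (Vert h i k 0) ->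
    forall j, (j < num_vert N k)%N -> on_col (Vert h i k j).
  move=> hM r0; elim=> // j IHj jn; have [colV _] := inP h.
  apply: (reached_linked (v := Vert h i k j)) => //.
  - by rewrite /= hM iR kK ltnW.
  - by right; apply: touches_Vert_Vert.
  - by apply: IHj; rewrite ltnW.
have on_col_horiz h : (h < M)%N -> on_col (Vert h i k 0) ->
    forall j, (j < num_horiz N k)%N -> on_col (Horiz h i k j).
  move=> hM r0; have [colV [colH _]] := inP h; elim=> [_|j IHj jn].
    apply: (reached_linked (v := Vert h i k (num_vert N k).-1)) => //.
    - by rewrite /= hM iR kK /=; lia.
    - by right; apply: touches_Horiz_Vert.
    - by apply: on_col_vert => //; lia.
  apply: (reached_linked (v := Horiz h i k j)) => //.
  - by rewrite /= hM iR kK ltnW.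
  - by left; apply: touches_Horiz_Horiz.
  - by apply: IHj; rewrite ltnW.
have on_col_diag h : (h < M)%N -> on_col (Vert h i k 0) ->
    forall d, on_col (Diag h i k ((num_diag N k).-1 - d)).
  move=> hM r0; have [_ [colH colD]] := inP h; elim=> [|d IHd].
    rewrite subn0; apply: (reached_linked (v := Horiz h i k (num_horiz N k).-1)) => //.
    - by rewrite /= hM iR kK /=; lia.
    - by left; apply: touches_Horiz_Diag.
    - by apply: on_col_horiz => //; lia.
  have [dn|dn] := ltnP d (num_diag N k).-1; last first.
    by rewrite (_ : (num_diag N k).-1 - d.+1 = (num_diag N k).-1 - d)%N //; lia.
  rewrite -(subnSK dn) in IHd *; apply: reached_linked IHd => //.
    by rewrite /= hM iR kK; lia.
  by right; apply: touches_Diag_Diag.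
have on_col_first h : (h < M)%N -> on_col (Vert h i k 0).
  elim: h => [_|h IHh hM]; first exact: reached_root.
  have := on_col_diag h (ltnW hM) (IHh (ltnW hM)) (num_diag N k).-1; rewrite subnn.
  apply: reached_linked; [|by have [_ [_ ->]] := inP h|by have [-> _] := inP h.+1|].
    by rewrite /= (ltnW hM) iR kK D0.
  by right; apply: touches_Vert_Diag.
apply: (piece_set_connected (rr := rr)) => v vv; rewrite /in_col.
case: v vv => //= h i' k' j /and4P[hM _ _ jn] /andP[/eqP iE /eqP kE]; subst i' k'.
- exact: on_col_vert (on_col_first h hM) _ jn.
- exact: on_col_horiz (on_col_first h hM) _ jn.
- have jE : j = ((num_diag N k).-1 - ((num_diag N k).-1 - j))%N by lia.
  by rewrite jE; apply: on_col_diag (on_col_first h hM) _.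
Qed.

Lemma in_row_disjoint h h' v : in_row h v -> in_row h' v -> h = h'.
Proof. by case: v => //= a _ /eqP <- /eqP <-. Qed.

Lemma in_col_disjoint i k i' k' v : in_col i k v -> in_col i' k' v -> i = i' /\ k = k'.
Proof.
rewrite /in_col; case: (line_of v) => [[[_ a] b]|//].
by move=> /andP[/eqP <- /eqP <-] /andP[/eqP <- /eqP <-].
Qed.

Lemma row_meets_col h i k : (h < M)%N -> (i < R)%N -> (k < K)%N ->
  exists u v, [/\ u \in piece_set (in_row h), v \in piece_set (in_col i k) & adj u v].
Proof.
move=> hM iR kK; have uu : valid (Hub h i) by rewrite /= hM ltnS ltnW.
have vv : valid (Diag h i k 0) by rewrite /= hM iR kK num_diag_gt0.
exists (vertex uu), (vertex vv); split.
- by rewrite inE /in_row /= eqxx.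
- by rewrite inE /in_col /= !eqxx.
- by apply: adj_linked => //; left; apply: touches_Hub_Diag.
Qed.

Lemma piece_graph_product (H : sgraph) (t k : nat) : M = (K * R)%N ->
  treewidth_le H t -> subgraph piece_graph (strong_product H (path_graph k)) ->
  (K * R <= t.+1 * (2 * (R.+2 + 3 * line_length N K)).+1)%N.
Proof.
move=> ME twH [f f_inj f_adj].
have near_root v : within (vertex (isT : valid Wall)) (R.+2 + 3 * line_length N K) v.
  by rewrite (vertexK v); apply: near_wall_all (vertex_valid v) _.
(* Column [c] consists of the lines number [c %/ R] at the tips number [c %% R]. *)
have index (c : 'I_(K * R)) : (c < M)%N /\ (c %% R < R)%N /\ (c %/ R < K)%N.
  have cKR := ltn_ord c; have : (0 < K * R)%N by apply: leq_ltn_trans cKR.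
  rewrite muln_gt0 => /andP[_ R0].
  by rewrite ME cKR ltn_pmod // ltn_divLR.
apply: (@product_bramble_bound _ _ _ _ _ _ _ f f_inj f_adj twH near_root
  (fun c => piece_set (in_row c)) (fun c => piece_set (in_col (c %% R) (c %/ R)))).
- by move=> c; have [cM _] := index c; apply: row_connected.
- by move=> c; have [cM [iR kK]] := index c; apply: col_connected => //; lia.
- by move=> c c' v; rewrite !inE => cv c'v; apply: val_inj; apply: in_row_disjoint cv c'v.
- move=> c c' v; rewrite !inE => cv c'v; apply: val_inj.
  have [cc' cc''] := in_col_disjoint cv c'v.
  by rewrite /= (divn_eq c R) (divn_eq c' R) cc' cc''.
- move=> c c'; have [cM _] := index c; have [_ [iR kK]] := index c'.
  exact: row_meets_col.
Qed.

End Collection.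

(** * Choice of the constants *)

Section NoProductStructure.
Variables (Rt : realType) (S : set (Rt * Rt)).
Hypothesis mS : measurable S.
Hypothesis S_triangle : forall z, S z -> [/\ 0 <= z.1, 0 <= z.2 & z.1 + z.2 <= 1].
Hypothesis S_square : forall z : Rt * Rt,
  0 <= z.1 -> z.1 <= 4^-1 -> 0 <= z.2 -> z.2 <= 4^-1 -> S z.
Hypothesis S_hleg : forall t, 0 <= t -> t <= 1 -> S (t, 0).
Hypothesis S_vleg : forall t, 0 <= t -> t <= 1 -> S (0, t).

Lemma no_product_structure (alpha : Rt) : alpha < 1 ->
  ~ admits_product_structure (intersection_class S alpha).
Proof.
move=> a1 [t prod].
have [N [N2 aN]] : exists N, (2 <= N)%N /\ 16 / N%:R <= 1 - alpha.
  have b0 : 0 < 1 - alpha by lra.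
  exists (Num.truncn (16 / (1 - alpha))).+2; split=> //.
  rewrite ler_pdivrMr ?ltr0n // mulrC -ler_pdivrMr //.
  by apply/ltW/(lt_trans (truncnS_gt _)); rewrite ltr_nat.
(* With [L] the line length, [2 (R + 2 + 3 L) + 1] equals [3 R], so the bound becomes [3 (t + 1) R],
   which is [K R - R]. *)
pose K := (3 * t.+1).+1; pose R := (6 * line_length N K + 5)%N; pose M := (K * R)%N.
have [H [k [twH sub]]] := prod _ (piece_graph_class mS S_triangle S_square
  (N := N) (K := K) M R N2 isT (ltW a1) aN).
have := piece_graph_product S_hleg S_vleg N2 (isT : (0 < K)%N) (erefl _) twH sub.
rewrite leqNgt => /negP; apply.
by rewrite /R; move: (line_length N K) => L; rewrite /K; lia.
Qed.

End NoProductStructure.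

Theorem theorem4 (R : realType) (n : nat) (hn : (3 <= n)%N) :
  exists S : set (R * R), is_ngon n S /\
    forall alpha : R, 0 <= alpha -> alpha < 1 ->
      ~ admits_product_structure (intersection_class S alpha).
Proof.
case: n hn => [|[|m]] // hm; have m0 : (0 < m)%N by [].
(* The right angle and the [m + 1] points on the parabola make up [n = m + 2] corners. *)
exists (@dent_region R m); split.
  by exists (@dent_vertex R m); rewrite filled_dentE //; split; first exact: dent_simple.
move=> alpha _; apply: no_product_structure.
- exact: measurable_dent_region.
- by move=> z; apply: dent_region_triangle.
- by move=> z; apply: dent_region_square.
- by move=> t; apply: dent_region_hleg.
- by move=> t; apply: dent_region_vleg.
Qed.
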